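(* The following statements hold. i) Let $\mu_k=0$, $k\in\mathbb{T}$. Then $\overline T^{(21)}_{k+1}=0$, $\overline P^{(11)}_k>0$, $\overline T^{(22)}_k>0$ for all $k\in\mathbb{T}$, with $$\overline T^{(22)}_k=s_k^2\,\overline T^{(22)}_{k+1},\quad k\in\mathbb{T},\qquad \overline T^{(22)}_N=1.$$ ii) Let $\mu_k=0$ and $\mathbb{E}\Theta_k\in\mathrm{Ran}[\mathrm{Cov}(\Theta_k)]$ for all $k\in\mathbb{T}$. Then for any initial pair $(t,z)$, Problem (MV) admits an open-loop self-coordination control, which is an open-loop time-consistent equilibrium control. iii) Let $\mathbb{E}\Theta_k\in\mathrm{Ran}[\mathrm{Cov}(\Theta_k)]$, $k\in\mathbb{T}$. Define $$\Xi_k=\big\{\Phi\,\big|\,\Phi=a_1\mathrm{Cov}(\Theta_k)+a_2\,\mathbb{E}\Theta_k(\mathbb{E}\Theta_k)^T,\ a_1,a_2\ge0\big\},\quad k\in\mathbb{T},$$ and let $\Phi_k\in\Xi_k$, $k\in\mathbb{T}$. Then for any initial pair, Problem (MV) admits an open-loop self-coordination control.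
   Context: Let $N\ge1$, $\mathbb{T}=\{0,\dots,N-1\}$, $\mathbb{T}_t=\{t,\dots,N-1\}$. $M^\dagger$ is the Moore-Penrose inverse; $\mathrm{Ran}(M)$ the range of $M$; $\succeq0$ means nonnegative definite. Market: $s_k>1$ ($k\in\mathbb{T}$) is the deterministic return of the riskless asset; $e_k=(e^1_k,\dots,e^{p_0}_k)^T$, $k\in\mathbb{T}$, are statistically independent random return vectors of $p_0$ risky assets with finite mean $\mathbb{E}e_k$ and covariance $\mathrm{Cov}(e_k)\succeq0$. $\Theta_k=(e^1_k-s_k,\dots,e^{p_0}_k-s_k)^T$, so $\mathrm{Cov}(\Theta_k)=\mathrm{Cov}(e_k)$. $\mathbb{F}^m_k=\sigma(e_\ell,\ell=0,\dots,k-1)$, $\mathbb{E}_k[\cdot]=\mathbb{E}[\cdot|\mathbb{F}^m_k]$. $l^2_{\mathbb{F}^m}(t;\mathbb{R}^n)$: $\mathbb{F}^m_t$-measurable square-integrable $\mathbb{R}^n$-valued variables; $l^2_{\mathbb{F}^m}(\mathbb{T}_t;\mathbb{R}^{p_0})$: processes $\{\nu_k\}_{k\in\mathbb{T}_t}$ with $\nu_k\in l^2_{\mathbb{F}^m}(k;\mathbb{R}^{p_0})$. The wealth under control $u$ satisfies $X_{k+1}=s_kX_k+\Theta_k^Tu_k$, $X_t=z$, $k\in\mathbb{T}_t$. Problem (MV): minimize over $u\in l^2_{\mathbb{F}^m}(\mathbb{T}_t;\mathbb{R}^{p_0})$ the functional $J_m(t,z;u)=\mathbb{E}_t[(X_N-\mathbb{E}_tX_N)^2]-\lambda\mathbb{E}_tX_N$,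 with $\lambda>0$. A control $v\in l^2_{\mathbb{F}^m}(\mathbb{T}_t;\mathbb{R}^{p_0})$ is an open-loop time-consistent equilibrium control of Problem (MV) for $(t,z)$ if $J_m(k,X_k;v|_{\mathbb{T}_k})\le J_m(k,X_k;(\bar v_k,v|_{\mathbb{T}_{k+1}}))$ for all $k\in\mathbb{T}_t$ and all $\bar v_k\in l^2_{\mathbb{F}^m}(k;\mathbb{R}^{p_0})$, where $X$ is the wealth under $v$ with $X_t=z$. Self-coordination: let $\mu_k\ge0$ and $\Phi_k\in\mathbb{R}^{p_0\times p_0}$ symmetric, $\Phi_k\succeq0$, and $\Upsilon_k=\mu_k\begin{pmatrix}\Phi_k&-\Phi_k\\-\Phi_k&\Phi_k\end{pmatrix}$. Define $$\widehat J_m(t,z;u,v)=\sum_{k=t}^{N-1}\mathbb{E}_t[\mu_k(u_k-v_k)^T\Phi_k(u_k-v_k)]+J_m(t,z;u),$$ $$\bar J_m(k,x;u|_{\mathbb{T}_k},v|_{\mathbb{T}_k})=\mu_k(u_k-v_k)^T\Phi_k(u_k-v_k)+J_m(k,x;v|_{\mathbb{T}_k}).$$ $v^*\in l^2_{\mathbb{F}^m}(\mathbb{T}_t;\mathbb{R}^{p_0})$ is an open-loop self-coordination control of Problem (MV) for the initial pair $(t,z)$ (and $\{\Upsilon_k,k\in\mathbb{T}_t\}$) if there is $u^*\in l^2_{\mathbb{F}^m}(\mathbb{T}_t;\mathbb{R}^{p_0})$ such that $$\widehat J_m(t,z;u^*,v^* )\le\widehat J_m(t,z;u,v^* )\quad\forall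 u\in l^2_{\mathbb{F}^m}(\mathbb{T}_t;\mathbb{R}^{p_0}),$$ $$\bar J_m(k,X^*_k;u^*|_{\mathbb{T}_k},v^*|_{\mathbb{T}_k})\le\bar J_m(k,X^*_k;u^*|_{\mathbb{T}_k},(v_k,v^*|_{\mathbb{T}_{k+1}}))\quad\forall k\in\mathbb{T}_t,\ \forall v_k\in l^2_{\mathbb{F}^m}(k;\mathbb{R}^{p_0}),$$ with $X^*_{k+1}=s_kX^*_k+\Theta_k^Tv^*_k$, $X^*_t=z$. Matrices: put $A_k=s_kI_2$, $B^1_k=\begin{pmatrix}(\mathbb{E}\Theta_k)^T\\0\end{pmatrix}$, $B^2_k=\begin{pmatrix}0\\(\mathbb{E}\Theta_k)^T\end{pmatrix}\in\mathbb{R}^{2\times p_0}$, $G^2=\begin{pmatrix}0&0\\0&1\end{pmatrix}$. The scalars $\overline P^{(11)}_k$ and $2\times2$ matrices $\overline T_k$ (entries $\overline T^{(ij)}_k$) are defined by backward recursion, $k\in\mathbb{T}$: $$\overline P^{(11)}_k=s_k^2\overline P^{(11)}_{k+1}\Big[1-\overline P^{(11)}_{k+1}(\mathbb{E}\Theta_k)^T(\overline{\mathbf{W}}_k^\dagger)^{(11)}\mathbb{E}\Theta_k\Big],\quad \overline P^{(11)}_N=1,$$ $$\overline T_k=A_k^T\overline T_{k+1}A_k-\big[(\overline H^{2(1)}_k)^T\ (\overline H^{2(2)}_k)^T\big]\overline{\mathbf{W}}_k^\dagger\begin{bmatrix}\overline H^{1(1)}_k\\0\end{bmatrix},\quad\overline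 T_N=G^2,$$ $$\overline H^{1(s)}_k=(B^s_k)^T\begin{pmatrix}\overline P^{(11)}_{k+1}&0\\0&0\end{pmatrix}A_k,\quad\overline H^{2(s)}_k=(B^s_k)^T\overline T_{k+1}A_k,\quad s=1,2,$$ $$\overline{\mathbf{W}}_k=\Upsilon_k+\begin{pmatrix}\overline P^{(11)}_{k+1}\mathbb{E}(\Theta_k\Theta_k^T)&0\\ \overline T^{(21)}_{k+1}\mathrm{Cov}(\Theta_k)&\overline T^{(22)}_{k+1}\mathrm{Cov}(\Theta_k)\end{pmatrix},$$ where $(\overline{\mathbf{W}}_k^\dagger)^{(11)}$ is the upper-left $p_0\times p_0$ block of $\overline{\mathbf{W}}_k^\dagger$.
   Formalization: In (i), P̄^(11)_k>0 is claimed only if EΘ_j∈Ran[Cov(Θ_j)] for all j with k≤j≤N−1; without this it fails (p_0=1, N=1, s_0=2, e_0=3 deterministic, μ_0=0 gives P̄^(11)_0=0), and the condition is also necessary. *)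

(* Defs.v *)
From HB Require Import structures.
From mathcomp Require Import all_boot all_order all_algebra.
From mathcomp Require Import all_classical all_reals all_analysis.

Set Implicit Arguments.
Unset Strict Implicit.
Unset Printing Implicit Defensive.

Import Order.TTheory GRing.Theory Num.Theory.

Local Open Scope classical_set_scope.
Local Open Scope ring_scope.

Section MoorePenrose.
Context {R : realType}.

Definition penrose m n (M : 'M[R]_(m, n)) (X : 'M[R]_(n, m)) : Prop :=
  [/\ M *m X *m M = M, X *m M *m X = X,
      (M *m X)^T = M *m X & (X *m M)^T = X *m M].

Definition mpinv m n (M : 'M[R]_(m, n)) : 'M[R]_(n, m) :=
  xget 0 [set X | penrose M X].

Let gram_unit r n (B : 'M[R]_(r, n)) : row_free B -> B *m B^T \in unitmx.
Proof.
move=> Bfree; rewrite -row_free_unit; apply: inj_row_free => v vBB0.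
suff vB0 : v *m B = 0 by rewrite -[v](mulmxKp Bfree) vB0 mul0mx.
have /matrixP/(_ 0 0) : (v *m B) *m (v *m B)^T = 0.
  by rewrite trmx_mul mulmxA -(mulmxA v) vBB0 mul0mx.
rewrite mxE [RHS]mxE => /eqP; rewrite psumr_eq0 => [/allP h|j _]; last first.
  by rewrite [_^T _ _]mxE -expr2 sqr_ge0.
apply/rowP => j; have := h j (mem_index_enum j).
by rewrite /= [_^T _ _]mxE -expr2 sqrf_eq0 [RHS]mxE => /eqP.
Qed.

Lemma mpinvP m n (M : 'M[R]_(m, n)) : penrose M (mpinv M).
Proof.
apply: (xgetPex 0).
have [r [C [B [CBM uC uB]]]] : exists (r : nat) (C : 'M[R]_(m, r)) (B : 'M[R]_(r, n)),
    [/\ (C *m B = M), C^T *m C \in unitmx & B *m B^T \in unitmx].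
  exists (\rank M), (col_base M), (row_base M); split.
  - exact: mulmx_base.
  - rewrite -[X in _ *m X]trmxK; apply: gram_unit.
    by rewrite /row_free mxrank_tr; exact: col_base_full.
  - by apply: gram_unit; exact: row_base_free.
have sB : (invmx (B *m B^T))^T = invmx (B *m B^T).
  by rewrite trmx_inv trmx_mul trmxK.
have sC : (invmx (C^T *m C))^T = invmx (C^T *m C).
  by rewrite trmx_inv trmx_mul trmxK.
pose X := B^T *m invmx (B *m B^T) *m (invmx (C^T *m C) *m C^T).
have MX : M *m X = C *m invmx (C^T *m C) *m C^T.
  by rewrite -CBM /X !mulmxA -(mulmxA C B) mulmxK.
have XM : X *m M = B^T *m invmx (B *m B^T) *m B.
  by rewrite -CBM /X -!mulmxA (mulmxA C^T) mulKmx.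
exists X; split.
- by rewrite MX -CBM -!mulmxA (mulmxA C^T) mulKmx.
- by rewrite XM /X -!mulmxA (mulmxA B) mulKVmx.
- by rewrite MX !trmx_mul trmxK sC mulmxA.
- by rewrite XM !trmx_mul trmxK sB mulmxA.
Qed.

Lemma penrose_uniq m n (M : 'M[R]_(m, n)) (X Y : 'M[R]_(n, m)) :
  penrose M X -> penrose M Y -> X = Y.
Proof.
move=> [x1 x2 x3 x4] [y1 y2 y3 y4].
have e1 : M *m X = M *m Y.
  by rewrite -x3 -{1}y1 -mulmxA trmx_mul x3 y3 mulmxA x1.
have e2 : X *m M = Y *m M.
  by rewrite -x4 -{1}y1 -!mulmxA mulmxA trmx_mul x4 y4 -mulmxA (mulmxA M) x1.
by rewrite -x2 e2 -mulmxA e1 mulmxA y2.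
Qed.

End MoorePenrose.

Section Matrices.
Context {R : realType}.

Definition quad n (M : 'M[R]_n) (x : 'cV[R]_n) : R := (x^T *m M *m x) 0 0.

Definition psd n (M : 'M[R]_n) : Prop :=
  M^T = M /\ forall x : 'cV[R]_n, 0 <= quad M x.

Definition in_range m n (M : 'M[R]_(m, n)) (y : 'cV[R]_m) : Prop :=
  exists x : 'cV[R]_n, M *m x = y.

End Matrices.

Section Probability.
Context {R : realType} {d : measure_display} {T : measurableType d}.
Context (P : probability T R).

Definition sigma_of {I : Type} n (e : I -> T -> 'cV[R]_n) (D : set I)
    : set (set T) :=
  <<s \bigcup_(l in D) \bigcup_(i in [set: 'I_n])
        preimage_set_system [set: T] (fun w => e l w i 0) measurable >>.

Definition measurable_wrt (G : set (set T)) (f : T -> R) : Prop :=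
  preimage_set_system [set: T] f measurable `<=` G.

Definition independent_vectors n (N : nat) (e : nat -> T -> 'cV[R]_n) : Prop :=
  forall (J : {set 'I_N}) (A : 'I_N -> set T),
    (forall k : 'I_N, k \in J -> sigma_of e [set (k : nat)] (A k)) ->
    (P (\bigcap_(k in [set` J]) A k) = \prod_(k in J) P (A k))%E.

(* [condE G X] is a version of E[X | G]; versions exist and are almost surely
   unique when X is integrable and G is a sub-sigma-algebra of measurable. *)
Definition is_condE (G : set (set T)) (X Y : T -> R) : Prop :=
  [/\ measurable_wrt G Y, P.-integrable [set: T] (EFin \o Y) &
      forall A, G A ->
        (\int[P]_(w in A) (Y w)%:E = \int[P]_(w in A) (X w)%:E)%E].

Definition condE (G : set (set T)) (X : T -> R) : T -> R :=
  xget (cst 0) [set Y | is_condE G X Y].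

Definition mean_vec n (X : T -> 'cV[R]_n) : 'cV[R]_n :=
  \col_i fine 'E_P[fun w => X w i 0].

Definition second_moment_mx n (X : T -> 'cV[R]_n) : 'M[R]_n :=
  \matrix_(i, j) fine 'E_P[fun w => X w i 0 * X w j 0].

Definition cov_mx n (X : T -> 'cV[R]_n) : 'M[R]_n :=
  \matrix_(i, j) fine (covariance P (fun w => X w i 0) (fun w => X w j 0)).

Definition square_integrable_vec n (X : T -> 'cV[R]_n) : Prop :=
  forall i, (fun w => X w i 0) \in Lfun P 2%:E.

End Probability.

(* Time-indexed data are total functions of [nat]; only the indices k < N
   matter. Relations between conditional functionals hold almost surely. *)
Section MeanVariance.
Context {R : realType} {d : measure_display} {T : measurableType d}.
Context (P : probability T R) {p : nat}.
Context (N : nat) (s : nat -> R) (e : nat -> T -> 'cV[R]_p) (lambda : R).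

Definition Theta (k : nat) (w : T) : 'cV[R]_p := e k w - const_mx (s k).

Definition Fm (k : nat) : set (set T) := sigma_of e [set l | (l < k)%N].

Definition l2 (k : nat) (f : T -> R) : Prop :=
  measurable_wrt (Fm k) f /\ f \in Lfun P 2%:E.

Definition l2_vec (k : nat) (f : T -> 'cV[R]_p) : Prop :=
  forall i, l2 k (fun w => f w i 0).

Definition control := nat -> T -> 'cV[R]_p.

Definition admissible (t : nat) (u : control) : Prop :=
  forall k, (t <= k < N)%N -> l2_vec k (u k).

Fixpoint wealth_after (t : nat) (z : T -> R) (u : control) (n : nat) : T -> R :=
  if n is n'.+1 then
    fun w => s (t + n')%N * wealth_after t z u n' w
             + ((Theta (t + n')%N w)^T *m u (t + n')%N w) 0 0
  else z.

Definition wealth (t : nat) (z : T -> R) (u : control) (k : nat) : T -> R :=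
  wealth_after t z u (k - t)%N.

Definition Jm (t : nat) (z : T -> R) (u : control) : T -> R :=
  let XN := wealth t z u N in
  let m := condE P (Fm t) XN in
  fun w => condE P (Fm t) (fun w' => (XN w' - m w') ^+ 2) w - lambda * m w.

(* As [Jm k] reads a control at times k, ..., N-1 only, [set_at v k vk] plays
   the role of (v_k, v|_{k+1, ..., N-1}) there. *)
Definition set_at (v : control) (k : nat) (vk : T -> 'cV[R]_p) : control :=
  fun j => if j == k then vk else v j.

Definition equilibrium_control (t : nat) (z : T -> R) (v : control) : Prop :=
  admissible t v /\
  forall k, (t <= k < N)%N ->
  forall vk : T -> 'cV[R]_p, l2_vec k vk ->
    {ae P, forall w, Jm k (wealth t z v k) v w
                     <= Jm k (wealth t z v k) (set_at v k vk) w}.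

Context (mu : nat -> R) (Phi : nat -> 'M[R]_p).

Definition Jhat (t : nat) (z : T -> R) (u v : control) : T -> R :=
  fun w =>
    \sum_(t <= k < N)
      condE P (Fm t) (fun w' => mu k * quad (Phi k) (u k w' - v k w')) w
    + Jm t z u w.

Definition Jbar (k : nat) (x : T -> R) (u v : control) : T -> R :=
  fun w => mu k * quad (Phi k) (u k w - v k w) + Jm k x v w.

Definition self_coordination_control (t : nat) (z : T -> R) (v : control)
    : Prop :=
  admissible t v /\
  exists u : control,
    [/\ admissible t u,
        forall u' : control, admissible t u' ->
          {ae P, forall w, Jhat t z u v w <= Jhat t z u' v w} &
        forall k, (t <= k < N)%N ->
        forall vk : T -> 'cV[R]_p, l2_vec k vk ->
          {ae P, forall w, Jbar k (wealth t z v k) u v w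
                 <= Jbar k (wealth t z v k) u (set_at v k vk) w}].

Definition Xi (k : nat) : set 'M[R]_p :=
  [set M | exists a1 a2 : R, [/\ 0 <= a1, 0 <= a2 &
     M = a1 *: cov_mx P (Theta k)
         + a2 *: (mean_vec P (Theta k) *m (mean_vec P (Theta k))^T)]].

(* Matrix indices start at 0: the (ij) entry is at position (i-1, j-1). *)

Definition Upsilon (k : nat) : 'M[R]_(p + p) :=
  mu k *: block_mx (Phi k) (- Phi k) (- Phi k) (Phi k).

Definition A_mx (k : nat) : 'M[R]_2 := (s k)%:M.

Definition B_mx (k : nat) (i : 'I_2) : 'M[R]_(2, p) :=
  \matrix_(a < 2, j < p) (if a == i then mean_vec P (Theta k) j 0 else 0).

Definition H1 (P1 : R) (k : nat) (i : 'I_2) : 'M[R]_(p, 2) :=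
  (B_mx k i)^T *m (P1 *: delta_mx 0 0) *m A_mx k.

Definition H2 (T1 : 'M[R]_2) (k : nat) (i : 'I_2) : 'M[R]_(p, 2) :=
  (B_mx k i)^T *m T1 *m A_mx k.

Definition W_mx (P1 : R) (T1 : 'M[R]_2) (k : nat) : 'M[R]_(p + p) :=
  Upsilon k +
  block_mx (P1 *: second_moment_mx P (Theta k)) 0
           (T1 1 0 *: cov_mx P (Theta k)) (T1 1 1 *: cov_mx P (Theta k)).

Definition P_step (P1 : R) (T1 : 'M[R]_2) (k : nat) : R :=
  s k ^+ 2 * P1 *
  (1 - P1 * ((mean_vec P (Theta k))^T *m ulsubmx (mpinv (W_mx P1 T1 k))
             *m mean_vec P (Theta k)) 0 0).

Definition T_step (P1 : R) (T1 : 'M[R]_2) (k : nat) : 'M[R]_2 :=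
  (A_mx k)^T *m T1 *m A_mx k
  - row_mx (H2 T1 k 0)^T (H2 T1 k 1)^T *m mpinv (W_mx P1 T1 k)
    *m col_mx (H1 P1 k 0) 0.

Fixpoint PT_before_end (n : nat) : R * 'M[R]_2 :=
  if n is n'.+1 then
    let: (P1, T1) := PT_before_end n' in
    (P_step P1 T1 (N - n), T_step P1 T1 (N - n))
  else (1, delta_mx 1 1).

Definition Pbar (k : nat) : R := (PT_before_end (N - k)).1.
Definition Tbar (k : nat) : 'M[R]_2 := (PT_before_end (N - k)).2.

Lemma PbarN : Pbar N = 1. Proof. by rewrite /Pbar subnn. Qed.

Lemma TbarN : Tbar N = delta_mx 1 1. Proof. by rewrite /Tbar subnn. Qed.

Lemma PbarE k : (k < N)%N -> Pbar k = P_step (Pbar k.+1) (Tbar k.+1) k.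
Proof.
move=> kN; rewrite /Pbar /Tbar -[in LHS](subnSK kN) /=.
by case: PT_before_end => a b /=; rewrite subnSK// subKn// ltnW.
Qed.

Lemma TbarE k : (k < N)%N -> Tbar k = T_step (Pbar k.+1) (Tbar k.+1) k.
Proof.
move=> kN; rewrite /Pbar /Tbar -[in LHS](subnSK kN) /=.
by case: PT_before_end => a b /=; rewrite subnSK// subKn// ltnW.
Qed.

End MeanVariance.

(* Main.v *)
Require Import Defs.
From HB Require Import structures.
From mathcomp Require Import all_boot all_order all_algebra.
From mathcomp Require Import ring lra.
From mathcomp Require Import all_classical all_reals all_analysis.
From mathcomp Require Import measurable_realfun.

Set Implicit Arguments.
Unset Strict Implicit.
Unset Printing Implicit Defensive.

Import Order.TTheory GRing.Theory Num.Theory.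
Import numFieldNormedType.Exports.
Import HBNNSimple.

Local Open Scope classical_set_scope.
Local Open Scope ring_scope.

(** The conditions characterising a self-coordination pair [(u, v)] are
    linear: each control is optimal for a convex quadratic problem, so
    optimality is orthogonality of a gradient to the variations. Since [E
    Theta_k = C_k y_k], with [C_k] the covariance, all gradients become
    multiples of [E Theta_k] when [u_k] and [v_k] are sought along [y_k], and
    the pair reduces to two scalar processes [alpha_k], [beta_k] driven by the
    excess return [xi_k = Theta_k^T y_k], whose mean [c_k] is also its
    variance. Both are affine in the state [w] with [w_{k+1} = w_k + xi_k
    alpha_k], which is the compounded wealth under [u] minus [E_t X_N + lambda
    / 2]; the coefficients solve a backward recursion whose determinant [g (1
    + f) + a (1 + c) (1 + g)] stays positive because [a] and [1 + f] do.
    Orthogonality is tested by expectations of products with square-integrable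
    variables known at time [k], evaluated by independence of [Theta_k] from
    the past and by the martingale property of the projected terminal wealth. *)

(** * Sub-sigma-algebras *)

(** The obstacle is that E_t X_N stands inside a square, so dynamic programming does not apply
    directly, and that u is optimised as a whole while v is optimised one time at a time. Gradients
    are therefore set to zero along an open-loop pair. The gradient for u is 2 (X_N - E_t X_N) -
    lambda; the shift by lambda / 2 in the state turns it into twice the final state. The unknown
    E_t X_N is then fixed by requiring the final state to have conditional mean - lambda / 2, an
    equation for the initial state that is solvable because a_t is positive. The wealth z cancels
    from X_N - E_t X_N, so the initial state is a constant. The wealth under v never enters the
    state, since the gradient for v at time k only sees how its terminal wealth deviates from the
    conditional mean. The factor 1 + c comes from E[Theta_k Theta_k^T] y_k = (1 + c_k) E Theta_k.
    Conditional expectations are arbitrary versions, so no conditional calculus is developed: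
    inequalities are integrated over events of the past, and squares are completed there. *)

Section SubSigmaAlgebra.
Context {R : realType} {d : measure_display} {T : measurableType d}.
Context (P : probability T R) (G : set (set T)).
Hypotheses (sG : sigma_algebra setT G) (Gm : G `<=` measurable).

Local Notation TG := (g_sigma_algebraType G).

Lemma measurable_subE (A : set T) : measurable (A : set TG) <-> G A.
Proof. by rewrite /measurable/= sigma_algebra_id. Qed.

Lemma measurable_wrtP (f : T -> R) :
  measurable_wrt G f <-> measurable_fun [set: TG] f.
Proof.
split=> [Gf _ Y mY|Gf A [Y mY <-]].
  by apply/measurable_subE; apply: Gf; exists Y.
by apply/measurable_subE; exact: Gf.
Qed.

Lemma measurable_wrt_fun (f : T -> R) :
  measurable_wrt G f -> measurable_fun [set: T] f.
Proof. by move=> Gf _ Y mY; apply: Gm; apply: Gf; exists Y. Qed.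

Lemma measurable_wrt_indic (A : set T) :
  G A -> measurable_wrt G (\1_A : T -> R).
Proof. by move=> /measurable_subE GA; apply/measurable_wrtP. Qed.

Lemma integral_setM_indic (A : set T) (f : T -> R) :
  (\int[P]_(x in A) (f x)%:E = \int[P]_x (\1_A x * f x)%:E)%E.
Proof.
rewrite integral_mkcond; apply: eq_integral => x _.
by rewrite patchE indicE; case: ifPn => _; rewrite ?mul1r ?mul0r.
Qed.

(** Approximating [h] by simple functions reduces both sides to integrals over level sets of the
    approximants, which are events of [G]. Both steps of the independence formula below are
    instances. *)
Lemma ge0_eq_integralM_wrt (f g h : T -> R) :
  measurable_fun [set: T] f -> (forall x, 0 <= f x) ->
  measurable_fun [set: T] g -> (forall x, 0 <= g x) ->
  measurable_wrt G h -> (forall x, 0 <= h x) ->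
  (forall B, G B -> \int[P]_(x in B) (f x)%:E = \int[P]_(x in B) (g x)%:E)%E ->
  (\int[P]_x (f x * h x)%:E = \int[P]_x (g x * h x)%:E)%E.
Proof.
move=> mf f0 mg g0 /measurable_wrtP mh h0 fgB.
(* The approximation lives on the type whose measurable sets are those of [G], so that the level
   sets of [h_ n] belong to [G]. *)
pose hE : TG -> \bar R := EFin \o (h : TG -> R).
have mhE : measurable_fun [set: TG] hE by exact/measurable_EFinP.
pose h_ := nnsfun_approx (@measurableT _ TG) mhE.
have h0E : forall x : TG, [set: TG] x -> (0 <= hE x)%E.
  by move=> x _; rewrite lee_fin.
have mh_ n : measurable_fun [set: T] (h_ n).
  by apply: measurable_wrt_fun; apply/measurable_wrtP; exact: measurable_funPT.
have mpre n y : G (h_ n @^-1` [set y]).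
  by apply/measurable_subE; exact: measurable_funPTI.
have mind n y : measurable_fun [set: T] (\1_(h_ n @^-1` [set y]) : T -> R).
  exact: measurable_wrt_fun (measurable_wrt_indic (mpre n y)).
have ch x : (EFin \o h_^~ x) n @[n --> \oo] --> (h x)%:E.
  by apply: (@cvg_nnsfun_approx _ _ _ _ _ _ mhE h0E x).
have nd x m n : (m <= n)%N -> h_ m x <= h_ n x.
  by move=> mn; have /lefP := nd_nnsfun_approx measurableT mhE mn; exact.
(* In this expansion [k] enters only through its integrals over level sets, where [f] and [g] agree
   by hypothesis. *)
suff key (k : T -> R) : measurable_fun [set: T] k -> (forall x, 0 <= k x) ->
    (\int[P]_x (k x * h x)%:E = limn (fun n => \sum_(y \in range (h_ n))
      (y%:E * \int[P]_(x in h_ n @^-1` [set y]) (k x)%:E)))%E.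
  rewrite !key//; congr (limn _); apply/funext => n.
  by apply: eq_fsbigr => y _; rewrite fgB.
move=> mk k0.
transitivity (limn (fun n => \int[P]_x (k x * h_ n x)%:E))%E.
  rewrite -monotone_convergence//.
  - apply: eq_integral => x _; apply/esym/cvg_lim => //.
    rewrite EFinM; under eq_fun do rewrite EFinM.
    by apply: cvgeZl => //; exact: ch.
  - by move=> n; apply/measurable_EFinP; exact: measurable_funM.
  - by move=> n x _; rewrite lee_fin mulr_ge0.
  - by move=> x _ m n mn; rewrite lee_fin ler_wpM2l// nd.
congr (limn _); apply/funext => n.
transitivity (\int[P]_x (\sum_(y \in range (h_ n))
    (k x * (y * \1_(h_ n @^-1` [set y]) x))%:E))%E.
  by apply: eq_integral => x _; rewrite fsumEFin// -mulr_fsumr -fimfunE.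
rewrite ge0_integral_fsum//; last 2 first.
- by move=> y; apply/measurable_EFinP; do 2 apply: measurable_funM => //.
- move=> y x _; rewrite lee_fin mulr_ge0//.
  by have := nnfun_muleindic_ge0 (h_ n) y x; rewrite lee_fin.
apply: eq_fsbigr => y; rewrite inE => -[x _ <-].
rewrite integral_setM_indic -ge0_integralZl//.
- by apply: eq_integral => z _; rewrite -EFinM; congr (_%:E); ring.
- by apply/measurable_EFinP; exact: measurable_funM.
- by move=> z _; rewrite lee_fin mulr_ge0// indicE.
- by rewrite lee_fin.
Qed.

End SubSigmaAlgebra.

(** * Means and square-integrable variables *)

Section Mean.
Context {R : realType} {d : measure_display} {T : measurableType d}.
Context (P : probability T R).
Implicit Types f g : T -> R.

Definition L1 f := P.-integrable [set: T] (EFin \o f).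
(** Real values let [ring] and [lra] act on expectations; the price is an integrability condition at
    each linearity step. *)
Definition mean f : R := \int[P]_x f x.

Lemma L1_measurable f : L1 f -> measurable_fun [set: T] f.
Proof. by move=> /measurable_int/measurable_EFinP. Qed.

Lemma eq_L1 f g : f =1 g -> L1 f -> L1 g.
Proof. by move=> /funext ->. Qed.

Lemma eq_mean f g : f =1 g -> mean f = mean g.
Proof. by move=> /funext ->. Qed.

Lemma L1D f g : L1 f -> L1 g -> L1 (fun x => f x + g x).
Proof. by move=> lf lg; have := integrableD measurableT lf lg. Qed.

Lemma L1Z a f : L1 f -> L1 (fun x => a * f x).
Proof. by move=> lf; have := integrableZl measurableT a lf. Qed.

Lemma L1N f : L1 f -> L1 (fun x => - f x).
Proof. by move=> lf; have := integrableN lf. Qed.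

Lemma L1B f g : L1 f -> L1 g -> L1 (fun x => f x - g x).
Proof. by move=> lf /L1N; exact: L1D. Qed.

Lemma L1_cst a : L1 (cst a).
Proof. exact: finite_measure_integrable_cst. Qed.

Lemma L1_sum (I : Type) (r : seq I) (Q : pred I) (F : I -> T -> R) :
  (forall i, Q i -> L1 (F i)) -> L1 (fun x => \sum_(i <- r | Q i) F i x).
Proof.
move=> lF; elim: r => [|i r ih].
  by apply: eq_L1 (L1_cst 0) => x; rewrite big_nil.
have [Qi|Qi] := boolP (Q i).
  by apply: eq_L1 (L1D (lF _ Qi) ih) => x; rewrite big_cons Qi.
by apply: eq_L1 ih => x; rewrite big_cons (negbTE Qi).
Qed.

Lemma L1_norm f : L1 f -> L1 (fun x => `|f x|).
Proof. by move=> lf; have := integrable_abse lf. Qed.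

Lemma L1_le f g : measurable_fun [set: T] f -> (forall x, `|f x| <= g x) ->
  L1 g -> L1 f.
Proof.
move=> mf fg; apply: le_integrable => //; first exact/measurable_EFinP.
by move=> x _ /=; rewrite lee_fin (le_trans (fg x))// ler_norm.
Qed.

Lemma L1_indicM A f : measurable A -> L1 f -> L1 (fun x => \1_A x * f x).
Proof.
move=> mA lf; apply: (L1_le _ _ (L1_norm lf)).
  by apply: measurable_funM => //; exact: L1_measurable.
by move=> x; rewrite normrM indicE; case: (_ \in _); rewrite ?normr1 ?mul1r// normr0 mul0r.
Qed.

Lemma mean_integral f : L1 f -> (\int[P]_x (f x)%:E)%E = (mean f)%:E.
Proof. by move=> lf; rewrite fineK// integrable_fin_num. Qed.

Lemma meanD f g : L1 f -> L1 g -> mean (fun x => f x + g x) = mean f + mean g.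
Proof. exact: RintegralD. Qed.

Lemma meanB f g : L1 f -> L1 g -> mean (fun x => f x - g x) = mean f - mean g.
Proof. exact: RintegralB. Qed.

Lemma meanZ a f : L1 f -> mean (fun x => a * f x) = a * mean f.
Proof. exact: RintegralZl. Qed.

Lemma mean_cst a : mean (fun=> a) = a.
Proof. by rewrite /mean Rintegral_cst//= probability_setT mulr1. Qed.

Lemma mean_sum (I : Type) (r : seq I) (Q : pred I) (F : I -> T -> R) :
  (forall i, Q i -> L1 (F i)) ->
  mean (fun x => \sum_(i <- r | Q i) F i x) = \sum_(i <- r | Q i) mean (F i).
Proof.
move=> lF; elim: r => [|i r ih].
  by rewrite big_nil -[RHS]mean_cst; apply: eq_mean => x; rewrite big_nil.
rewrite big_cons; case: ifPn => Qi; last first.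
  by rewrite -ih; apply: eq_mean => x; rewrite big_cons (negbTE Qi).
rewrite -ih -meanD; [|exact: lF|exact: L1_sum].
by apply: eq_mean => x; rewrite big_cons Qi.
Qed.

Lemma mean_ge0 f : (forall x, 0 <= f x) -> 0 <= mean f.
Proof. by move=> f0; exact: Rintegral_ge0. Qed.

Lemma ae_eq_mean f g : L1 f -> L1 g -> {ae P, forall x, f x = g x} ->
  mean f = mean g.
Proof.
move=> lf lg fg; rewrite /mean /Rintegral; congr fine.
apply: ae_eq_integral => //; try exact: measurable_int.
- exact: measurable_int lf.
- exact: measurable_int lg.
by apply: filterS fg => x /= ->.
Qed.

Definition L2 f := measurable_fun [set: T] f /\ L1 (fun x => f x ^+ 2).

Lemma eq_L2 f g : f =1 g -> L2 f -> L2 g.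
Proof. by move=> /funext ->. Qed.

Lemma L2P f : f \in Lfun P 2%:E <-> L2 f.
Proof.
split=> [l2f|[mf lf]].
  split; last exact: Lfun2_integrable_sqr.
  by move: l2f; rewrite inE => /andP[/[!inE]].
rewrite inE; apply/andP; split; rewrite inE//= /finite_norm unlock /Lnorm.
rewrite poweR_lty//=; move: lf => /integrableP[_].
congr (_ < _)%E; apply: eq_integral => x _ /=.
by rewrite powR_mulrn// ger0_norm ?sqr_ge0// real_normK// num_real.
Qed.

Lemma L1M f g : L2 f -> L2 g -> L1 (fun x => f x * g x).
Proof.
by move=> /L2P lf /L2P lg; have /Lfun1_integrable := Lfun2_mul_Lfun1 lf lg.
Qed.

Lemma L2_cst a : L2 (cst a).
Proof. by split => //; exact: L1_cst (a ^+ 2). Qed.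

Lemma L2_L1 f : L2 f -> L1 f.
Proof.
move=> lf; apply: eq_L1 (L1M lf (L2_cst 1)) => x; by rewrite /= mulr1.
Qed.

Lemma L2D f g : L2 f -> L2 g -> L2 (fun x => f x + g x).
Proof.
move=> lf lg; split; first by apply: measurable_funD; [case: lf|case: lg].
apply: (@eq_L1 (fun x => f x ^+ 2 + 2 * (f x * g x) + g x ^+ 2)).
  by move=> x; ring.
by apply: L1D (lg.2); apply: L1D (lf.2) _; exact/L1Z/L1M.
Qed.

Lemma L2Z a f : L2 f -> L2 (fun x => a * f x).
Proof.
move=> [mf lf]; split; first exact: measurable_funM.
by apply: eq_L1 (L1Z (a ^+ 2) lf) => x; ring.
Qed.

Lemma L2N f : L2 f -> L2 (fun x => - f x).
Proof. by move=> /(L2Z (-1)); under eq_fun do rewrite mulN1r. Qed.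

Lemma L2B f g : L2 f -> L2 g -> L2 (fun x => f x - g x).
Proof. by move=> lf /L2N; exact: L2D. Qed.

Lemma L2_sum (I : Type) (r : seq I) (Q : pred I) (F : I -> T -> R) :
  (forall i, Q i -> L2 (F i)) -> L2 (fun x => \sum_(i <- r | Q i) F i x).
Proof.
move=> lF; elim: r => [|i r ih].
  by apply: eq_L2 (L2_cst 0) => x; rewrite big_nil.
have [Qi|Qi] := boolP (Q i).
  by apply: eq_L2 (L2D (lF _ Qi) ih) => x; rewrite big_cons Qi.
by apply: eq_L2 ih => x; rewrite big_cons (negbTE Qi).
Qed.

Lemma L2_indicM A f : measurable A -> L2 f -> L2 (fun x => \1_A x * f x).
Proof.
move=> mA [mf lf]; split; first exact: measurable_funM.
apply: eq_L1 (L1_indicM mA lf) => x.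
by rewrite exprMn indicE; case: (_ \in _); rewrite ?expr1n// expr0n.
Qed.

End Mean.

(** * Variables known to a sub-sigma-algebra *)

Section MeasurableWrt.
Context {R : realType} {d : measure_display} {T : measurableType d}.
Context (P : probability T R) (G : set (set T)).
Hypotheses (sG : sigma_algebra setT G) (Gm : G `<=` measurable).
Implicit Types f g : T -> R.

Lemma eq_measurable_wrt f g : f =1 g -> measurable_wrt G f -> measurable_wrt G g.
Proof. by move=> /funext ->. Qed.

Lemma measurable_wrt_cst a : measurable_wrt G (cst a : T -> R).
Proof. exact/(measurable_wrtP sG). Qed.
Arguments measurable_wrt_cst a : clear implicits.

Lemma measurable_wrtD f g : measurable_wrt G f -> measurable_wrt G g ->
  measurable_wrt G (fun x => f x + g x).
Proof.
move=> /(measurable_wrtP sG) mf /(measurable_wrtP sG) mg.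
by apply/(measurable_wrtP sG); exact: measurable_funD.
Qed.

Lemma measurable_wrtM f g : measurable_wrt G f -> measurable_wrt G g ->
  measurable_wrt G (fun x => f x * g x).
Proof.
move=> /(measurable_wrtP sG) mf /(measurable_wrtP sG) mg.
by apply/(measurable_wrtP sG); exact: measurable_funM.
Qed.

Lemma measurable_wrtZ a f : measurable_wrt G f ->
  measurable_wrt G (fun x => a * f x).
Proof. exact/measurable_wrtM/measurable_wrt_cst. Qed.
Arguments measurable_wrtZ a [f].

Lemma measurable_wrtB f g : measurable_wrt G f -> measurable_wrt G g ->
  measurable_wrt G (fun x => f x - g x).
Proof.
move=> mf /(measurable_wrtZ (-1)) mg; apply: eq_measurable_wrt (measurable_wrtD mf mg).
by move=> x; rewrite mulN1r.
Qed.

Lemma measurable_wrt_norm f : measurable_wrt G f ->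
  measurable_wrt G (fun x => `|f x|).
Proof.
move=> /(measurable_wrtP sG) mf.
by apply/(measurable_wrtP sG); exact: measurableT_comp.
Qed.

Lemma measurable_wrt_sum (I : Type) (r : seq I) (Q : pred I) (F : I -> T -> R) :
  (forall i, Q i -> measurable_wrt G (F i)) ->
  measurable_wrt G (fun x => \sum_(i <- r | Q i) F i x).
Proof.
move=> lF; elim: r => [|i r ih].
  by apply: eq_measurable_wrt (measurable_wrt_cst 0) => x; rewrite big_nil.
have [Qi|Qi] := boolP (Q i).
  apply: eq_measurable_wrt (measurable_wrtD (lF _ Qi) ih) => x.
  by rewrite big_cons Qi.
by apply: eq_measurable_wrt ih => x; rewrite big_cons (negbTE Qi).
Qed.

Lemma measurable_wrt_lt f g : measurable_wrt G f -> measurable_wrt G g ->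
  G [set x | f x < g x].
Proof.
move=> mf mg; have := measurable_wrtB mg mf => mgf.
have -> : [set x | f x < g x] = setT `&` (fun x => g x - f x) @^-1` `]0, +oo[.
  by rewrite setTI; apply/seteqP; split=> x /=; rewrite in_itv/= andbT subr_gt0.
by apply: mgf; exists `]0, +oo[%classic.
Qed.

(** The space of test variables; at [G = Fm e k] it is [l2 P e k], see [l2E]. *)
Definition L2G f := measurable_wrt G f /\ L2 P f.

Lemma eq_L2G f g : f =1 g -> L2G f -> L2G g.
Proof. by move=> /funext ->. Qed.

Lemma L2G_cst a : L2G (cst a).
Proof. by split; [exact: measurable_wrt_cst|exact: L2_cst]. Qed.

Lemma L2GD f g : L2G f -> L2G g -> L2G (fun x => f x + g x).
Proof. by move=> [? ?] [? ?]; split; [exact: measurable_wrtD|exact: L2D]. Qed.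

Lemma L2GB f g : L2G f -> L2G g -> L2G (fun x => f x - g x).
Proof. by move=> [? ?] [? ?]; split; [exact: measurable_wrtB|exact: L2B]. Qed.

Lemma L2GZ a f : L2G f -> L2G (fun x => a * f x).
Proof. by move=> [? ?]; split; [exact: measurable_wrtZ|exact: L2Z]. Qed.

Lemma L2G_sum (I : Type) (r : seq I) (Q : pred I) (F : I -> T -> R) :
  (forall i, Q i -> L2G (F i)) -> L2G (fun x => \sum_(i <- r | Q i) F i x).
Proof.
by move=> lF; split; [apply: measurable_wrt_sum|apply: L2_sum] => i /lF[].
Qed.

Lemma L2G_indicM A f : G A -> L2G f -> L2G (fun x => \1_A x * f x).
Proof.
move=> GA [? ?]; split; last by apply: L2_indicM => //; exact: Gm.
by apply: measurable_wrtM => //; exact: measurable_wrt_indic.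
Qed.

(* The test set is [{g < f}], on which [f - g] is positive with integral <= 0. *)
Lemma ae_le_wrt f g :
  measurable_wrt G f -> measurable_wrt G g -> L1 P f -> L1 P g ->
  (forall A, G A -> mean P (fun x => \1_A x * f x) <=
                    mean P (fun x => \1_A x * g x)) ->
  {ae P, forall x, f x <= g x}.
Proof.
move=> mf mg lf lg fg; pose A := [set x | g x < f x].
have GA : G A by exact: measurable_wrt_lt.
have mA := Gm GA.
pose h x := \1_A x * (f x - g x).
have h0 x : 0 <= h x.
  rewrite /h indicE; case: (boolP (x \in A)) => [|_]; last by rewrite mul0r.
  by rewrite inE /A/= mul1r subr_ge0 => /ltW.
have lh : L1 P h by apply: L1_indicM => //; exact: L1B.
have h_eq0 : mean P h = 0.
  apply/eqP; rewrite eq_le mean_ge0// andbT.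
  rewrite (@eq_mean _ _ _ _ h (fun x => \1_A x * f x - \1_A x * g x)).
    by rewrite meanB; [rewrite subr_le0 fg|exact: L1_indicM..].
  by move=> x; rewrite /h mulrBr.
have : ae_eq P setT (EFin \o h) (cst 0%E).
  apply/ae_eq_integral_abs => //; first exact: measurable_int lh.
  rewrite -[RHS]/(0%:E) -h_eq0 -mean_integral//.
  by apply: eq_integral => x _ /=; rewrite ger0_norm.
apply: filterS => x /(_ I)/= [hx]; rewrite leNgt; apply/negP => gf.
move: hx; rewrite /h indicE mem_set//= mul1r => /eqP; rewrite subr_eq0 => /eqP fgx.
by rewrite fgx ltxx in gf.
Qed.

Lemma ae_eq_wrt f g :
  measurable_wrt G f -> measurable_wrt G g -> L1 P f -> L1 P g ->
  (forall A, G A -> mean P (fun x => \1_A x * f x) =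
                    mean P (fun x => \1_A x * g x)) ->
  {ae P, forall x, f x = g x}.
Proof.
move=> mf mg lf lg fg.
have h1 : {ae P, forall x, f x <= g x} by apply: ae_le_wrt => // A /fg ->.
have h2 : {ae P, forall x, g x <= f x} by apply: ae_le_wrt => // A /fg ->.
by apply: filterS2 h1 h2 => x fgx gfx; apply/eqP; rewrite eq_le fgx.
Qed.

Lemma mean_setM A f : measurable A -> L1 P f ->
  (\int[P]_(x in A) (f x)%:E)%E = (mean P (fun x => \1_A x * f x))%:E.
Proof.
by move=> mA lf; rewrite integral_setM_indic mean_integral//; exact: L1_indicM.
Qed.

Lemma is_condEP X Y : L1 P X -> is_condE P G X Y <->
  [/\ measurable_wrt G Y, L1 P Y & forall A, G A ->
    mean P (fun x => \1_A x * Y x) = mean P (fun x => \1_A x * X x)].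
Proof.
move=> lX; split=> -[mY lY XY]; split => // A GA; have mA := Gm GA.
  by have := XY A GA; rewrite !mean_setM// => -[].
by rewrite !mean_setM// XY.
Qed.

(** Radon-Nikodym on the coarser space: pushed forward along the identity from [T] to [TG], the
    charge with density [X] is dominated by the restriction of [P] to [G], and its density there is
    automatically [G]-measurable. *)
Lemma ex_condE X : L1 P X -> exists Y, is_condE P G X Y.
Proof.
move=> lX.
pose TG := g_sigma_algebraType G.
have mid : measurable_fun [set: T] (id : T -> TG).
  by move=> _ A /(measurable_subE sG) GA; rewrite setTI; exact: Gm.
pose idM := isMeasurableFun.Build _ _ _ _ _ mid.
pose idG : {mfun T >-> TG} := HB.pack (id : T -> TG) idM.
pose PG : probability TG R := distribution P idG.
pose nu : {charge set TG -> \bar R} :=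
  measure_function_pushforward__canonical__charge_Charge (induced_charge lX) mid.
have nuE A : nu A = (\int[P]_(x in A) (X x)%:E)%E by [].
have nuP : nu `<< PG.
  apply/null_content_dominatesP => A /(measurable_subE sG) /Gm mA PA0.
  rewrite nuE; apply: null_set_integral => //.
  by apply: measurable_funTS; exact: measurable_int lX.
pose D := Radon_Nikodym nu PG.
have Dfin x : D x \is a fin_num by exact: Radon_Nikodym_fin_num.
have Dint : PG.-integrable setT D by exact: Radon_Nikodym_integrable.
have DA A : measurable (A : set TG) -> nu A = (\int[PG]_(x in A) D x)%E.
  exact: Radon_Nikodym_integral.
have mD : measurable_fun [set: TG] D by exact: measurable_int Dint.
pose Y : T -> R := fun x => fine (D x).
have YD : EFin \o Y = D \o idG by apply/funext => x; rewrite /= /Y fineK.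
have mY : measurable_wrt G Y.
  by apply/(measurable_wrtP sG); exact: measurableT_comp.
have lY : P.-integrable setT (EFin \o Y).
  apply/integrableP; split.
    by apply/measurable_EFinP; exact: (measurable_wrt_fun Gm).
  have /integrableP[_] := Dint; apply: le_lt_trans.
  rewrite /PG /distribution ge0_integral_pushforward//; last first.
    exact: measurableT_comp.
  rewrite preimage_setT le_eqVlt; apply/orP; left; apply/eqP.
  by apply: eq_integral => x _; rewrite YD.
exists Y; split => // A GA.
have mA : measurable (A : set TG) by exact/(measurable_subE sG).
rewrite -nuE DA// /PG /distribution integral_pushforward//.
- by apply: eq_integral => x _; rewrite -[RHS]/((D \o idG) x) -YD.
- rewrite -YD; apply: (integrableS measurableT) => //.
  by rewrite /idG/= preimage_id; exact: Gm.
Qed.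

End MeasurableWrt.

Arguments measurable_wrt_cst {R d T G} sG a.
Arguments measurable_wrtZ {R d T G} sG a {f}.

(** * Conditional expectation *)

Section ConditionalExpectation.
Context {R : realType} {d : measure_display} {T : measurableType d}.
Context (P : probability T R) (G : set (set T)).
Hypotheses (sG : sigma_algebra setT G) (Gm : G `<=` measurable).
Implicit Types X Y : T -> R.

Lemma le_mean X Y : L1 P X -> L1 P Y -> (forall x, X x <= Y x) ->
  mean P X <= mean P Y.
Proof. by move=> lX lY XY; apply: le_Rintegral. Qed.

Lemma is_condE_condE X : L1 P X -> is_condE P G X (condE P G X).
Proof. by move=> /(ex_condE sG Gm) [Y XY]; exact: (xgetPex (cst 0) (ex_intro _ Y XY)). Qed.

Lemma is_condE_sum (I : Type) (r : seq I) (Q : pred I) (F F' : I -> T -> R) :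
  (forall i, Q i -> L1 P (F i)) ->
  (forall i, Q i -> is_condE P G (F i) (F' i)) ->
  is_condE P G (fun x => \sum_(i <- r | Q i) F i x)
               (fun x => \sum_(i <- r | Q i) F' i x).
Proof.
move=> lF FF'; have FF i : Q i -> _ := fun Qi => (is_condEP Gm _ (lF i Qi)).1 (FF' i Qi).
apply/(is_condEP Gm); first exact: L1_sum.
split.
- by apply: measurable_wrt_sum => // i /FF[].
- by apply: L1_sum => // i /FF[].
move=> A GA; have mA := Gm GA.
have sumE (H : I -> T -> R) : (forall i, Q i -> L1 P (H i)) ->
    mean P (fun x => \1_A x * \sum_(i <- r | Q i) H i x) =
    \sum_(i <- r | Q i) mean P (fun x => \1_A x * H i x).
  move=> lH; rewrite -mean_sum; last by move=> i Qi; apply: L1_indicM => //; exact: lH.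
  by apply: eq_mean => x; rewrite mulr_sumr.
rewrite !sumE//; last by move=> i /FF[].
by apply: eq_bigr => i /FF[_ _]; exact.
Qed.

(* Conditional Jensen: [X^2 >= 2 q X - q^2] for each rational [q], and the
   supremum over [q] of the conditional right-hand sides is [condE X ^ 2]. *)
Lemma L2G_condE X : L2 P X -> L2G P G (condE P G X).
Proof.
move=> lX; have l1X := L2_L1 lX.
have [mM lM ME] := (is_condEP Gm _ l1X).1 (is_condE_condE l1X).
have [mQ lQ QE] := (is_condEP Gm _ lX.2).1 (is_condE_condE lX.2).
set M := condE P G X in mM lM ME *; set Q := condE P G _ in mQ lQ QE.
have tangent q : {ae P, forall x, 2 * q * M x - q ^+ 2 <= Q x}.
  apply: (ae_le_wrt sG Gm) => //.
  - by apply: measurable_wrtB => //; [exact: measurable_wrtZ|exact: measurable_wrt_cst].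
  - by apply: L1B; [exact: L1Z|exact: L1_cst].
  move=> A GA; have mA := Gm GA; rewrite QE//.
  have lin Z : L1 P Z -> mean P (fun x => \1_A x * (2 * q * Z x - q ^+ 2)) =
      2 * q * mean P (fun x => \1_A x * Z x) - mean P (fun x => \1_A x * q ^+ 2).
    move=> lZ; rewrite -meanZ; last exact: L1_indicM.
    rewrite -meanB; [|by apply: L1Z; exact: L1_indicM|exact: (L1_indicM mA (L1_cst P _))].
    by apply: eq_mean => x; ring.
  rewrite lin// ME// -lin//; apply: le_mean.
  - by apply: L1_indicM => //; apply: L1B; [exact: L1Z|exact: L1_cst].
  - by apply: L1_indicM => //; exact: lX.2.
  move=> x; apply: ler_wpM2l; first by rewrite indicE.
  by rewrite -subr_ge0 (_ : _ - _ = (X x - q) ^+ 2) ?sqr_ge0//; ring.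
have MQ : {ae P, forall x, M x ^+ 2 <= Q x}.
  (* The rationals are enumerated by [unpickle] to intersect countably many almost sure events; a
     code of no rational carries a trivial claim. *)
  have : {ae P, forall x, forall n, if unpickle n is Some q then
      2 * ratr q * M x - ratr q ^+ 2 <= Q x else true}.
    apply: ae_foralln => n; case: (unpickle n) => [q|]; first exact: tangent.
    exact: nearW.
  apply: filterS => x Mx.
  have {}Mx (q : rat) : 2 * ratr q * M x - ratr q ^+ 2 <= Q x.
    by have := Mx (pickle q); rewrite pickleK.
  rewrite leNgt; apply/negP => QM.
  (* For [q] in []M x, M x + eps[] the tangent is [M x ^+ 2 - (q - M x) ^+ 2], above
     [M x ^+ 2 - eps ^+ 2]; the cap at 1 gives [eps ^+ 2 <= eps], so it exceeds [Q x]. *)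
  pose eps := Num.min 1 (M x ^+ 2 - Q x).
  have eps0 : 0 < eps by rewrite lt_min ltr01 subr_gt0.
  have /rat_in_itvoo[q] : M x < M x + eps by rewrite ltrDl.
  rewrite in_itv/= => /andP[q1 q2]; have := Mx q.
  have e1 : eps <= 1 by rewrite ge_min lexx.
  have e2 : eps <= M x ^+ 2 - Q x by rewrite ge_min lexx orbT.
  nra.
split => //; split; first exact: measurable_wrt_fun mM.
have mM2 : measurable_fun [set: T] (fun x => M x ^+ 2).
  by apply: measurable_funX; exact: measurable_wrt_fun mM.
apply/integrableP; split; first exact/measurable_EFinP.
have /integrableP[_] := lQ; apply: le_lt_trans; apply: ae_ge0_le_integral => //.
- by apply: measurableT_comp => //; exact/measurable_EFinP.
- by apply: measurableT_comp => //; exact: measurable_int lQ.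
apply: filterS MQ => x MQx _ /=; rewrite lee_fin (le_trans _ (ler_norm _))//.
by rewrite ger0_norm ?sqr_ge0.
Qed.

(** Convexity of the mean-variance functional: beyond its linear part the increment is the square of
    the change in the centred variable, so the first-order inequality on each event of [G] suffices.
    [M] is an explicit candidate for the conditional mean of [X], recognised by orthogonality; [F]
    and [F'] are the penalties, with conditional versions [H] and [H']. *)
Lemma ae_le_mean_variance_wrt (lambda : R) (X X' M F F' H H' m m' v v' : T -> R) :
  L2 P X -> L2 P X' -> L2G P G M ->
  (forall Z, L2G P G Z -> mean P (fun x => Z x * (X x - M x)) = 0) ->
  L1 P F -> L1 P F' -> is_condE P G F H -> is_condE P G F' H' ->
  L2G P G m -> L2G P G m' -> is_condE P G X m -> is_condE P G X' m' ->
  is_condE P G (fun x => (X x - m x) ^+ 2) v ->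
  is_condE P G (fun x => (X' x - m' x) ^+ 2) v' ->
  (forall A, G A -> 0 <= mean P (fun x =>
     \1_A x * (F' x - F x + (2 * (X x - M x) - lambda) * (X' x - X x)))) ->
  {ae P, forall x, H x + (v x - lambda * m x) <=
                   H' x + (v' x - lambda * m' x)}.
Proof.
move=> lX lX' [mM lM] orth lF lF' /(is_condEP Gm _ lF)[mH lH HE]
  /(is_condEP Gm _ lF')[mH' lH' HE'] l2m l2m'
  /(is_condEP Gm _ (L2_L1 lX))[mm lm mE]
  /(is_condEP Gm _ (L2_L1 lX'))[mm' lm' mE'].
have l1V : L1 P (fun x => (X x - m x) ^+ 2) by have [] := L2B lX l2m.2.
have l1V' : L1 P (fun x => (X' x - m' x) ^+ 2) by have [] := L2B lX' l2m'.2.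
move=> /(is_condEP Gm _ l1V)[mv lv vE] /(is_condEP Gm _ l1V')[mv' lv' vE'] opt.
(* Indicators of [G] among the test variables identify the candidate with the given version. *)
have m_eq : {ae P, forall x, m x = M x}.
  apply: (ae_eq_wrt sG Gm) => //; first exact: L2_L1.
  move=> A GA; have mA := Gm GA; rewrite mE//; apply/eqP; rewrite -subr_eq0.
  rewrite -meanB; [|by apply: L1_indicM => //; exact: L2_L1..].
  rewrite -(orth _ (L2G_indicM sG Gm GA (L2G_cst P sG 1))); apply/eqP.
  by apply: eq_mean => x; rewrite /= mulr1 mulrBr.
have lXM : L2 P (fun x => X x - M x) by exact: L2B.
have lXm : L2 P (fun x => X x - m x) by apply: L2B lX l2m.2.
have orthm Z : L2G P G Z -> mean P (fun x => Z x * (X x - m x)) = 0.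
  move=> lZ; rewrite -(orth _ lZ); case: lZ => mZ lZ.
  by apply: ae_eq_mean; [exact: L1M..|apply: filterS m_eq => x ->].
apply: (ae_le_wrt sG Gm).
- exact: (measurable_wrtD sG mH
    (measurable_wrtB sG mv (measurable_wrtZ sG lambda mm))).
- exact: (measurable_wrtD sG mH'
    (measurable_wrtB sG mv' (measurable_wrtZ sG lambda mm'))).
- exact: (L1D lH (L1B lv (L1Z lambda lm))).
- exact: (L1D lH' (L1B lv' (L1Z lambda lm'))).
move=> A GA; have mA := Gm GA.
have lin a b c : L1 P a -> L1 P b -> L1 P c ->
    mean P (fun x => \1_A x * (a x + (b x - lambda * c x))) =
    mean P (fun x => \1_A x * a x) + (mean P (fun x => \1_A x * b x)
      - lambda * mean P (fun x => \1_A x * c x)).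
  move=> /(L1_indicM mA) la /(L1_indicM mA) lb /(L1_indicM mA) lc.
  rewrite -meanZ// -meanB//; last exact: L1Z.
  rewrite -meanD//; last by apply: L1B => //; exact: L1Z.
  by apply: eq_mean => x; ring.
have l1X := L2_L1 lX; have l1X' := L2_L1 lX'.
rewrite !lin// (HE A GA) (HE' A GA) (vE A GA) (vE' A GA) (mE A GA) (mE' A GA).
rewrite -!lin//.
have lD : L2 P (fun x => X' x - X x) by exact: L2B.
have lK Z : L2 P Z -> L1 P (fun x => \1_A x *
    (F' x - F x + (2 * (X x - Z x) - lambda) * (X' x - X x))).
  move=> lZ; apply: L1_indicM => //; apply: L1D; first exact: L1B.
  by apply: L1M => //; apply: L2B; [apply: L2Z; exact: L2B|exact: L2_cst].
have lZ : L2G P G (fun x => \1_A x * (m' x - m x)).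
  by apply: L2G_indicM => //; apply: L2GB => //.
have lJ a b c : L1 P a -> L1 P b -> L1 P c ->
    L1 P (fun x => \1_A x * (a x + (b x - lambda * c x))).
  move=> la lb lc; apply: L1_indicM => //; apply: L1D => //.
  by apply: L1B => //; exact: L1Z.
have lZX : L1 P (fun x => 2 * (\1_A x * (m' x - m x) * (X x - m x))).
  by apply: L1Z; apply: L1M lXm; case: lZ.
rewrite -subr_ge0 -meanB; [|exact: lJ..].
(* The subtracted term has mean zero, as [m' - m] is known to [G]; it is exactly what completes the
   square. *)
apply: (@le_trans _ _ (mean P (fun x => \1_A x *
    (F' x - F x + (2 * (X x - m x) - lambda) * (X' x - X x))
    - 2 * (\1_A x * (m' x - m x) * (X x - m x))))).
  rewrite meanB//; last exact: (lK m l2m.2).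
  rewrite meanZ ?orthm//; last by apply: L1M lXm; case: lZ.
  rewrite mulr0 subr0 (ae_eq_mean (lK _ l2m.2) (lK _ lM)) ?opt//.
  by apply: filterS m_eq => x ->.
apply: le_mean.
- by apply: L1B lZX; exact: (lK m l2m.2).
- by apply: L1B; exact: lJ.
move=> x; rewrite -subr_ge0.
rewrite (_ : _ - _ = \1_A x * ((X' x - m' x) - (X x - m x)) ^+ 2); last by ring.
by rewrite mulr_ge0 ?sqr_ge0// indicE.
Qed.

Lemma ae_le_mean_variance (lambda : R) (X X' M F F' H H' : T -> R) :
  L2 P X -> L2 P X' -> L2G P G M ->
  (forall Z, L2G P G Z -> mean P (fun x => Z x * (X x - M x)) = 0) ->
  L1 P F -> L1 P F' -> is_condE P G F H -> is_condE P G F' H' ->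
  (forall A, G A -> 0 <= mean P (fun x =>
     \1_A x * (F' x - F x + (2 * (X x - M x) - lambda) * (X' x - X x)))) ->
  let V Y := condE P G (fun x => (Y x - condE P G Y x) ^+ 2) in
  {ae P, forall x, H x + (V X x - lambda * condE P G X x) <=
                   H' x + (V X' x - lambda * condE P G X' x)}.
Proof.
move=> lX lX' lM orth lF lF' HF HF' opt V.
have condEP Y : L2 P Y -> is_condE P G Y (condE P G Y).
  by move=> /L2_L1 /is_condE_condE.
have VP Y : L2 P Y -> is_condE P G (fun x => (Y x - condE P G Y x) ^+ 2) (V Y).
  by move=> lY; apply: is_condE_condE; have [] := L2B lY (L2G_condE lY).2.
exact: (ae_le_mean_variance_wrt lX lX' lM orth lF lF' HF HF' (L2G_condE lX)
  (L2G_condE lX') (condEP _ lX) (condEP _ lX') (VP _ lX) (VP _ lX') opt).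
Qed.

End ConditionalExpectation.

(** * Independence *)

Section Independence.
Context {R : realType} {d : measure_display} {T : measurableType d}.
Context (P : probability T R) (G H : set (set T)).
Hypotheses (sG : sigma_algebra setT G) (Gm : G `<=` measurable).
Hypotheses (sH : sigma_algebra setT H) (Hm : H `<=` measurable).
Hypothesis indep : forall A B, G A -> H B -> P (A `&` B) = (P A * P B)%E.
Implicit Types f g : T -> R.

(** One factor is averaged at a time: against events [B] of [H], [f] may be replaced by its mean,
    because against events [A] of [G] the indicator of [B] may be replaced by its probability. The
    last claim is independence of [A] and [B]. *)
Lemma ge0_integralM_indep f g : measurable_wrt G f -> measurable_wrt H g ->
  L1 P f -> L1 P g -> (forall x, 0 <= f x) -> (forall x, 0 <= g x) ->
  (\int[P]_x (f x * g x)%:E = (mean P f * mean P g)%:E)%E.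
Proof.
move=> mf mg lf lg f0 g0.
transitivity (\int[P]_x (cst (mean P f) x * g x)%:E)%E; last first.
  by rewrite (mean_integral (L1Z (mean P f) lg)) meanZ.
apply: (ge0_eq_integralM_wrt sH Hm) => //.
- exact: measurable_wrt_fun mf.
- by move=> x; exact: mean_ge0.
move=> B HB; have mB := Hm HB.
rewrite [RHS](integral_cst P mB (mean P f)%:E) integral_setM_indic.
have PB : (P B = (fine (P B))%:E)%E by rewrite fineK// fin_num_measure.
transitivity (\int[P]_x (cst (fine (P B)) x * f x)%:E)%E; last first.
  by rewrite (mean_integral (L1Z (fine (P B)) lf)) meanZ// EFinM -PB muleC.
apply: (ge0_eq_integralM_wrt sG Gm) => //.
- by move=> x; exact: fine_ge0.
move=> A GA; have mA := Gm GA.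
rewrite [RHS](integral_cst P mA (fine (P B))%:E) -PB integral_indic//.
by rewrite setIC muleC; apply: indep.
Qed.

Let ge0_mean f g : measurable_wrt G f -> measurable_wrt H g ->
  L1 P f -> L1 P g -> (forall x, 0 <= f x) -> (forall x, 0 <= g x) ->
  L1 P (fun x => f x * g x) /\
  mean P (fun x => f x * g x) = mean P f * mean P g.
Proof.
move=> mf mg lf lg f0 g0; have fg := ge0_integralM_indep mf mg lf lg f0 g0.
split; last by rewrite /mean /Rintegral fg.
apply/integrableP; split.
  by apply/measurable_EFinP; apply: measurable_funM;
    [exact: (measurable_wrt_fun Gm)|exact: (measurable_wrt_fun Hm)].
rewrite (eq_integral (fun x => (f x * g x)%:E)) ?fg ?ltry// => x _.
by rewrite /= ger0_norm// mulr_ge0.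
Qed.

(** Independence lets merely integrable factors have an integrable product; applied to squares, this
    is what keeps controlled gains square-integrable. *)
Lemma L1M_indep f g : measurable_wrt G f -> measurable_wrt H g ->
  L1 P f -> L1 P g -> L1 P (fun x => f x * g x).
Proof.
move=> mf mg lf lg.
have [l _] := ge0_mean (measurable_wrt_norm sG mf) (measurable_wrt_norm sH mg)
  (L1_norm lf) (L1_norm lg) (fun x => normr_ge0 _) (fun x => normr_ge0 _).
apply: L1_le l => [|x]; last by rewrite normrM.
by apply: measurable_funM;
    [exact: (measurable_wrt_fun Gm)|exact: (measurable_wrt_fun Hm)].
Qed.

(** Writing [f] as [(f + |f|) - |f|], and [g] likewise, gives nonnegative measurable pieces to which
    the nonnegative case applies. *)
Lemma meanM_indep f g : measurable_wrt G f -> measurable_wrt H g ->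
  L1 P f -> L1 P g -> mean P (fun x => f x * g x) = mean P f * mean P g.
Proof.
move=> mf mg lf lg.
have shift K (h : T -> R) : sigma_algebra setT K -> measurable_wrt K h -> L1 P h ->
    [/\ measurable_wrt K (fun x => h x + `|h x|), L1 P (fun x => h x + `|h x|) &
        forall x, 0 <= h x + `|h x|].
  move=> sK mh lh; split.
  - by apply: measurable_wrtD => //; exact: measurable_wrt_norm.
  - by apply: L1D => //; exact: L1_norm.
  - by move=> x; rewrite -lerBlDr sub0r lerNnormlW.
have [mf1 lf1 f1] := shift _ _ sG mf lf.
have [mg1 lg1 g1] := shift _ _ sH mg lg.
have mf2 := measurable_wrt_norm sG mf; have mg2 := measurable_wrt_norm sH mg.
have lf2 := L1_norm lf; have lg2 := L1_norm lg.
have f2 x : 0 <= `|f x| by []. have g2 x : 0 <= `|g x| by [].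
have [l11 e11] := ge0_mean mf1 mg1 lf1 lg1 f1 g1.
have [l12 e12] := ge0_mean mf1 mg2 lf1 lg2 f1 g2.
have [l21 e21] := ge0_mean mf2 mg1 lf2 lg1 f2 g1.
have [l22 e22] := ge0_mean mf2 mg2 lf2 lg2 f2 g2.
rewrite (@eq_mean _ _ _ _ _ (fun x =>
  ((f x + `|f x|) * (g x + `|g x|) - (f x + `|f x|) * `|g x|) -
  (`|f x| * (g x + `|g x|) - `|f x| * `|g x|))); last by move=> x; ring.
rewrite !meanB ?e11 ?e12 ?e21 ?e22//; [|exact: L1B..].
by rewrite !meanD//; ring.
Qed.

End Independence.

(** * Sigma-algebras generated by the return vectors *)

Section SigmaOf.
Context {R : realType} {d : measure_display} {T : measurableType d}.
Context (P : probability T R) {n : nat} (e : nat -> T -> 'cV[R]_n).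

Lemma sigma_ofP D : sigma_algebra setT (sigma_of e D).
Proof. exact: smallest_sigma_algebra. Qed.

Lemma sigma_ofS D D' : D `<=` D' -> sigma_of e D `<=` sigma_of e D'.
Proof. by move=> DD'; apply: sub_sigma_algebra2; exact: bigcup_subset. Qed.

Lemma sigma_of_measurable D :
  (forall l i, D l -> measurable_fun [set: T] (fun w => e l w i 0)) ->
  sigma_of e D `<=` measurable.
Proof.
move=> me; apply: smallest_sub; first exact: sigma_algebra_measurable.
by move=> A [l Dl] [i _] [Y mY <-]; exact: me.
Qed.

Lemma measurable_wrt_sigma_of D l i : D l ->
  measurable_wrt (sigma_of e D) (fun w => e l w i 0).
Proof. by move=> Dl A mA; apply: sub_sigma_algebra; exists l => //; exists i. Qed.

(** Cylinders, intersections of one event per earlier time, form a pi-system generating the past. On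
    it the finite measures [P (_]&[B)] and [P B * P _] agree, hence they agree on the whole
    generated sigma-algebra. *)
Lemma independent_past N k : (k < N)%N ->
  (forall l i, (l < N)%N -> measurable_fun [set: T] (fun w => e l w i 0)) ->
  independent_vectors P N e ->
  forall A B, sigma_of e [set l | (l < k)%N] A -> sigma_of e [set k] B ->
  P (A `&` B) = (P A * P B)%E.
Proof.
move=> kN me ind A B FA sB.
have sm l : (l < N)%N -> sigma_of e [set l] `<=` measurable.
  by move=> lN; apply: sigma_of_measurable => _ i ->; exact: me.
have mB : measurable B by exact: sm sB.
pose J := [set l : 'I_N | (l < k)%N]%SET.
pose cyl (C : 'I_N -> set T) := \bigcap_(l in [set` J]) C l.
pose Pi : set (set T) :=
  [set cyl C | C in [set C | forall l : 'I_N, sigma_of e [set (l : nat)] (C l)]].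
have PiI : setI_closed Pi.
  move=> _ _ [C sC <-] [C' sC' <-]; exists (fun l => C l `&` C' l).
    move=> l; have sl := sigma_ofP [set (l : nat)].
    by apply/(measurable_subE sl)/measurableI; exact/(measurable_subE sl).
  by rewrite /cyl bigcapI.
have Pim : Pi `<=` measurable.
  move=> _ [C sC <-]; apply: fin_bigcap_measurable => // l _.
  exact: sm (sC l).
have genPi : sigma_of e [set l | (l < k)%N] `<=` <<s Pi >>.
  apply: sub_sigma_algebra2 => C [l lk] [i _] Ci.
  have lN : (l < N)%N := ltn_trans lk kN.
  (* A generating event at time [l] is the cylinder whose other sides are the whole space. *)
  exists (fun j : 'I_N => if j == Ordinal lN then C else setT).
    move=> j; case: eqP => [->|_].
      by apply: sub_sigma_algebra; exists l => //; exists i.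
    exact/(measurable_subE (sigma_ofP [set (j : nat)])).
  rewrite /cyl; apply/seteqP; split => [x /(_ (Ordinal lN))|x Cx j _].
    by rewrite eqxx; apply; rewrite /= inE.
  by case: ifP.
have Pi_indep C : Pi C -> P (C `&` B) = (P C * P B)%E.
  move=> [D sD <-{C}]; pose o := Ordinal kN.
  have oJ : o \notin J by rewrite inE ltnn.
  (* [B] becomes the side at time [k] of a longer cylinder, to which mutual independence applies. *)
  have [K sK KE] : exists2 K : 'I_N -> set T,
      (forall l : 'I_N, sigma_of e [set (l : nat)] (K l)) &
      K o = B /\ forall l, l != o -> K l = D l.
    exists (fun l => if l == o then B else D l).
      by move=> l; case: eqP => [->|].
    by split; [rewrite eqxx|move=> l /negbTE ->].
  have -> : cyl D `&` B = \bigcap_(l in [set` (o |: J)%SET]) K l.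
    apply/seteqP; split => [x [Dx Bx] l|x Kx].
      rewrite /= in_setU1 => /orP[/eqP->|lJ]; first by rewrite KE.1.
      by rewrite KE.2; [exact: Dx|apply: contraNneq oJ => <-].
    split; last by rewrite -KE.1; apply: Kx; rewrite /= setU11.
    move=> l lJ; rewrite -KE.2; last by apply: contraNneq oJ => <-.
    by apply: Kx; rewrite /= in_setU1 [_ \in J]lJ orbT.
  rewrite ind; last by move=> l _; exact: sK.
  rewrite big_setU1//= KE.1 muleC; congr (_ * _)%E.
  rewrite [RHS]ind; last by move=> l _; exact: sD.
  by apply: eq_bigr => l lJ; rewrite KE.2//; apply: contraNneq oJ => <-.
have PB : (P B = (fine (P B))%:E)%E by rewrite fineK// fin_num_measure.
pose m1 := mrestr P mB.
pose m2 := mscale (NngNum (fine_ge0 (measure_ge0 P B))) P.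
have m2E C : m2 C = (P C * P B)%E by rewrite muleC PB.
suff : m1 A = m2 A by rewrite m2E.
pose Pi' := [set X | Pi X /\ X `<=` [set: T]].
have Pi'E : Pi' = Pi by apply/seteqP; split => [X []|X ?] //; split.
apply: (@g_sigma_algebra_measure_unique_trace _ _ _ Pi setT measurableT).
- by rewrite -/Pi' Pi'E.
- by rewrite -/Pi' Pi'E.
- by apply: etrans (esym (m2E _)); rewrite probability_setT mul1e /m1/= /mrestr setTI.
- by move=> C [PC _]; apply: etrans (esym (m2E _)); exact: Pi_indep.
- by rewrite /m1/= /mrestr setTI PB ltry.
- by move=> X _ x.
- by rewrite -/Pi' Pi'E; exact: genPi.
Qed.

End SigmaOf.

(** * Second moments *)

Section Moments.
Context {R : realType} {d : measure_display} {T : measurableType d}.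
Context (P : probability T R) {p : nat} (X : T -> 'cV[R]_p).
Hypothesis X2 : forall i, L2 P (fun w => X w i 0).

Lemma fine_expectation (f : T -> R) : fine 'E_P[f] = mean P f.
Proof. by rewrite unlock. Qed.

Lemma mean_vecE i : mean_vec P X i 0 = mean P (fun w => X w i 0).
Proof. by rewrite mxE fine_expectation. Qed.

Lemma second_moment_mxE i j :
  second_moment_mx P X i j = mean P (fun w => X w i 0 * X w j 0).
Proof. by rewrite mxE fine_expectation. Qed.

Lemma second_moment_cov :
  second_moment_mx P X = cov_mx P X + mean_vec P X *m (mean_vec P X)^T.
Proof.
apply/matrixP => i j; rewrite 2!mxE [cov_mx _ _ _ _]mxE [(_ *m _) _ _]mxE big_ord1.
have l1 i' : (fun w => X w i' 0) \in Lfun P 1 by exact/Lfun1_integrable/L2_L1.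
have l11 : ((fun w => X w i 0) * (fun w => X w j 0))%R \in Lfun P 1.
  by apply/Lfun1_integrable; exact: (L1M (X2 i) (X2 j)).
rewrite covarianceE// fineB ?fin_numM ?expectation_fin_num//.
by rewrite fineM ?expectation_fin_num// !mxE subrK.
Qed.

Lemma trmx_second_moment : (second_moment_mx P X)^T = second_moment_mx P X.
Proof.
apply/matrixP => i j; rewrite mxE !second_moment_mxE.
by apply: eq_mean => w; rewrite mulrC.
Qed.

Variable y : 'cV[R]_p.
Hypothesis Cy : cov_mx P X *m y = mean_vec P X.

Let c : R := ((mean_vec P X)^T *m y) 0 0.

(** The rank-one part contributes [c] times the mean, so [y] is sent to a multiple of the mean by
    covariance and second moment alike. *)
Lemma second_moment_mul : second_moment_mx P X *m y = (1 + c) *: mean_vec P X.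
Proof.
rewrite second_moment_cov mulmxDl Cy -mulmxA scalerDl scale1r; congr (_ + _).
by rewrite [_^T *m _]mx11_scalar mul_mx_scalar.
Qed.

Let xi (w : T) : R := ((X w)^T *m y) 0 0.

Lemma dot_sumE w : xi w = \sum_i y i 0 * X w i 0.
Proof. by rewrite /xi mxE; apply: eq_bigr => i _; rewrite mxE mulrC. Qed.

Lemma L2_dot : L2 P xi.
Proof.
by apply: eq_L2 (fun w => esym (dot_sumE w)) _; apply: L2_sum => i _; exact: L2Z (X2 i).
Qed.

Lemma mean_dot : mean P xi = c.
Proof.
rewrite (eq_mean P dot_sumE) mean_sum; last by move=> i _; apply: L1Z; exact: L2_L1 (X2 i).
rewrite /c mxE; apply: eq_bigr => i _; rewrite meanZ; last exact: L2_L1 (X2 i).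
by rewrite [_^T _ _]mxE mean_vecE mulrC.
Qed.

Lemma mean_mul_dot i : mean P (fun w => X w i 0 * xi w) = (1 + c) * mean_vec P X i 0.
Proof.
have -> : (1 + c) * mean_vec P X i 0 = (second_moment_mx P X *m y) i 0.
  by rewrite second_moment_mul [RHS]mxE.
rewrite mxE (@eq_mean _ _ _ _ _ (fun w => \sum_j y j 0 * (X w i 0 * X w j 0))).
  rewrite mean_sum => [|j _]; last by apply: L1Z; exact: L1M (X2 i) (X2 j).
  by apply: eq_bigr => j _; rewrite (meanZ _ (L1M (X2 i) (X2 j))) second_moment_mxE mulrC.
by move=> w; rewrite dot_sumE mulr_sumr; apply: eq_bigr => j _; ring.
Qed.

Lemma mean_dot_sqr : mean P (fun w => xi w * xi w) = (1 + c) * c.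
Proof.
rewrite (@eq_mean _ _ _ _ _ (fun w => \sum_i y i 0 * (X w i 0 * xi w))); last first.
  by move=> w; rewrite {1}dot_sumE mulr_suml; apply: eq_bigr => j _; ring.
rewrite mean_sum => [|i _]; last by apply: L1Z; exact: L1M (X2 i) L2_dot.
rewrite {2}/c mxE mulr_sumr; apply: eq_bigr => i _.
rewrite meanZ; last exact: L1M (X2 i) L2_dot.
by rewrite mean_mul_dot [_^T _ _]mxE; ring.
Qed.

(** [c] is also the variance of [xi]: its second moment is [(1 + c) * c], and subtracting [c ^+ 2]
    leaves [c]. *)
Lemma mean_dot_ge0 : 0 <= c.
Proof.
have : 0 <= mean P (fun w => (xi w - c) ^+ 2) by apply: mean_ge0 => w; exact: sqr_ge0.
have lxi := L2_dot.
rewrite (@eq_mean _ _ _ _ _ (fun w => xi w * xi w - (2 * c * xi w - c ^+ 2))); last first.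
  by move=> w; ring.
have l1 := L2_L1 lxi; have lcst := L1_cst P (c ^+ 2).
rewrite meanB; [|exact: L1M|by apply: L1B => //; exact: L1Z].
rewrite meanB//; last exact: L1Z.
by rewrite meanZ// mean_cst mean_dot mean_dot_sqr (_ : _ - _ = c)//; ring.
Qed.

(** With [K] symmetric, the mean is [kappa] times [K *m y]; the first Penrose identity then
    collapses the form to [kappa] times the product of [y] with the mean, which is [kappa * c]. *)
Lemma mpinv_second_moment (a : R) : 0 < a ->
  a * ((mean_vec P X)^T *m mpinv (a *: second_moment_mx P X) *m mean_vec P X) 0 0
  = c / (1 + c).
Proof.
move=> a0; set K := a *: second_moment_mx P X.
have c1 : 1 + c != 0 by apply: lt0r_neq0; exact: ltr_pwDl ltr01 mean_dot_ge0.
have ac : a * (1 + c) != 0 by apply: mulf_neq0 => //; exact: lt0r_neq0.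
have KT : K^T = K by rewrite /K linearZ/= trmx_second_moment.
have Ky : mean_vec P X = (a * (1 + c))^-1 *: (K *m y).
  by rewrite -scalemxAl second_moment_mul (scalerA a) scalerA mulVf ?scale1r.
have [K1 _ _ _] := mpinvP K.
clearbody K.
set kappa := (a * (1 + c))^-1 in Ky *.
have mT : (mean_vec P X)^T = kappa *: (y^T *m K).
  by rewrite {1}Ky linearZ/= trmx_mul KT.
have -> : (mean_vec P X)^T *m mpinv K *m mean_vec P X =
    kappa *: (y^T *m mean_vec P X).
  rewrite mT -!scalemxAl; congr (_ *: _).
  rewrite [in LHS]Ky [in RHS]Ky -!scalemxAr; congr (_ *: _).
  have -> : y^T *m K *m mpinv K *m (K *m y) = y^T *m (K *m mpinv K *m K) *m y.
    by rewrite !mulmxA.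
  by rewrite K1 mulmxA.
have -> : y^T *m mean_vec P X = ((mean_vec P X)^T *m y)^T by rewrite trmx_mul trmxK.
rewrite mxE [X in _ * (_ * X)]mxE -/c /kappa; field.
by rewrite c1 gt_eqF.
Qed.

End Moments.

(** * The recursion without penalty *)

Lemma mpinv_block_diag (R : realType) m n m' n' (A : 'M[R]_(m, n)) (B : 'M[R]_(m', n')) :
  mpinv (block_mx A 0 0 B) = block_mx (mpinv A) 0 0 (mpinv B).
Proof.
have [A1 A2 A3 A4] := mpinvP A; have [B1 B2 B3 B4] := mpinvP B.
apply: penrose_uniq (mpinvP _) _.
by split; rewrite !mulmx_block !(mulmx0, mul0mx, addr0, add0r)
  ?tr_block_mx ?trmx0 ?(A1, A2, A3, A4, B1, B2, B3, B4).
Qed.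

Section Riccati.
Context {R : realType} {d : measure_display} {T : measurableType d}.
Context (P : probability T R) {p N : nat} (s : nat -> R).
Context (e : nat -> T -> 'cV[R]_p) (mu : nat -> R) (Phi : nat -> 'M[R]_p).
Hypothesis e_L2 : forall k, (k < N)%N -> square_integrable_vec P (e k).

Lemma L2_Theta k i : (k < N)%N -> L2 P (fun w => Theta s e k w i 0).
Proof.
move=> kN; apply: (@eq_L2 _ _ _ _ (fun w => e k w i 0 - s k)).
  by move=> w; rewrite /Theta !mxE.
by apply: L2B; [apply/L2P; exact: e_L2|exact: L2_cst].
Qed.

Hypothesis s_gt1 : forall k, (k < N)%N -> 1 < s k.

Variables (P1 : R) (T1 : 'M[R]_2) (k : nat).
Hypotheses (kN : (k < N)%N) (muk : mu k = 0).
Hypotheses (T10 : T1 1 0 = 0) (T01 : T1 0 1 = 0).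

Let W := W_mx P s e mu Phi P1 T1 k.
Let m := mean_vec P (Theta s e k).

Lemma mpinv_W : mpinv W =
  block_mx (mpinv (P1 *: second_moment_mx P (Theta s e k))) 0
           0 (mpinv (T1 1 1 *: cov_mx P (Theta s e k))).
Proof. by rewrite /W /W_mx /Upsilon muk scale0r add0r T10 scale0r mpinv_block_diag. Qed.

Lemma T_stepE i j : T_step P s e mu Phi P1 T1 k i j = s k ^+ 2 * T1 i j -
  ((H2 P s e T1 k 0)^T *m mpinv (P1 *: second_moment_mx P (Theta s e k)) *m
     H1 P s e P1 k 0) i j.
Proof.
rewrite /T_step -/W mpinv_W mul_row_block mul_row_col !mulmx0 !addr0.
rewrite mxE [X in _ + X]mxE; congr (_ - _).
by rewrite /A_mx tr_scalar_mx mul_scalar_mx mul_mx_scalar scalerA mxE expr2.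
Qed.

(** Row 1 of the correction term carries the factor [T1 0 1], which vanishes. *)
Lemma T_step1 j : T_step P s e mu Phi P1 T1 k 1 j = s k ^+ 2 * T1 1 j.
Proof.
rewrite T_stepE -mulmxA mxE big1 ?subr0// => l _; rewrite mxE.
rewrite /H2 /A_mx mul_mx_scalar mxE mxE big_ord_recl big_ord1.
rewrite !mxE /= (_ : lift _ _ = 1); last exact/val_inj.
by rewrite T01 /= !(mulr0, mul0r, addr0).
Qed.

Lemma T_step01 : T_step P s e mu Phi P1 T1 k 0 1 = 0.
Proof.
rewrite T_stepE T01 mulr0 mxE big1 ?subr0// => l _.
rewrite /H1 /A_mx mul_mx_scalar [X in _ * X]mxE [X in _ * (_ * X)]mxE big1 ?mulr0// => i _.
by rewrite !mxE andbF !mulr0.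
Qed.

(** The bracket of the recursion equals [1 - c / (1 + c)], that is [1 / (1 + c)]. *)
Lemma P_step_gt0 : 0 < P1 -> in_range (cov_mx P (Theta s e k)) m ->
  0 < P_step P s e mu Phi P1 T1 k.
Proof.
move=> P10 [y Cy].
have X2 i := L2_Theta i kN.
rewrite /P_step -/W mpinv_W block_mxKul -/m (mpinv_second_moment X2 Cy P10).
have c0 := mean_dot_ge0 X2 Cy; set c := (_ *m y) 0 0 in c0 *.
have s0 : 0 < s k by exact: lt_trans (s_gt1 kN).
rewrite !mulr_gt0 ?exprn_gt0// subr_gt0 ltr_pdivrMr ?mul1r ?ltrDr// ltr_pwDl//.
Qed.

End Riccati.

Section RiccatiSequence.
Context {R : realType} {d : measure_display} {T : measurableType d}.
Context (P : probability T R) {p N : nat} (s : nat -> R).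
Context (e : nat -> T -> 'cV[R]_p) (mu : nat -> R) (Phi : nat -> 'M[R]_p).
Hypothesis e_L2 : forall k, (k < N)%N -> square_integrable_vec P (e k).
Hypothesis s_gt1 : forall k, (k < N)%N -> 1 < s k.
Hypothesis mu0 : forall k, (k < N)%N -> mu k = 0.

Local Notation Pk := (Pbar P N s e mu Phi).
Local Notation Tk := (Tbar P N s e mu Phi).

Lemma backward_ind (Q : nat -> Prop) : Q N ->
  (forall k, (k < N)%N -> Q k.+1 -> Q k) -> forall k, (k <= N)%N -> Q k.
Proof.
move=> QN Qk k kN; rewrite -(subKn kN); elim: (N - k)%N (leq_subr k N) => [|n ih] nN.
  by rewrite subn0.
apply: Qk; first by rewrite ltn_subrL (leq_trans _ nN).
by rewrite subnSK//; exact/ih/ltnW.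
Qed.

(** The upper-right entry joins the induction because it drives the correction to the second row. *)
Lemma Tbar_mu0 k : (k <= N)%N ->
  [/\ Tk k 1 0 = 0, Tk k 0 1 = 0 & 0 < Tk k 1 1].
Proof.
move: k; apply: backward_ind => [|k kN [T10 T01 T11]].
  by rewrite TbarN !mxE.
have muk := mu0 kN.
rewrite TbarE// T_step01// !T_step1// T10 mulr0; split => //.
by rewrite mulr_gt0// exprn_gt0// (lt_trans ltr01)// s_gt1.
Qed.

Lemma Pbar_gt0 k : (k <= N)%N ->
  (forall j, (k <= j < N)%N ->
     in_range (cov_mx P (Theta s e j)) (mean_vec P (Theta s e j))) ->
  0 < Pk k.
Proof.
move: k; apply: backward_ind => [_|k kN ih range]; first by rewrite PbarN.
have [T10 T01 _] := Tbar_mu0 kN.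
rewrite PbarE//;  apply: (P_step_gt0 Phi e_L2 s_gt1) => //; first exact: mu0.
  by apply: ih => j /andP[/ltnW kj jN]; apply: range; rewrite kj.
by apply: range; rewrite leqnn.
Qed.

End RiccatiSequence.

(** * Feedback coefficients *)

Section Feedback.
Context {R : realType} (N : nat) (g c : nat -> R) (l : R).
Hypotheses (g_ge0 : forall k, (k < N)%N -> 0 <= g k).
Hypotheses (c_ge0 : forall k, (k < N)%N -> 0 <= c k).

Lemma ex_backward (X : Type) (x0 : X) (step : nat -> X -> X) :
  exists x : nat -> X, x N = x0 /\ forall k, (k < N)%N -> x k = step k (x k.+1).
Proof.
exists (fun k => foldr step x0 (iota k (N - k))); split; first by rewrite subnn.
by move=> k kN; rewrite -(subnSK kN).
Qed.

(* [a w + b] and [f w + h] are the conditional expectations, given the state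
   [w], of the final state and of the remaining gains of the other player;
   [alpha1 w + alpha0] and [beta1 w + beta0] solve the two first-order
   conditions. *)
Lemma ex_feedback : exists a b f h alpha1 alpha0 beta1 beta0 : nat -> R,
  [/\ a N = 1, b N = 0, f N = 0, h N = 0 &
   (forall k, (k <= N)%N -> 0 < a k) /\
   forall k w, (k < N)%N ->
     let alpha := alpha1 k * w + alpha0 k in
     let beta := beta1 k * w + beta0 k in
     [/\ g k * (alpha - beta) + a k.+1 * (w + (1 + c k) * alpha) + b k.+1 = 0,
         g k * (beta - alpha) + beta + f k.+1 * alpha - l = 0,
         a k * w + b k = a k.+1 * (w + c k * alpha) + b k.+1 &
         f k * w + h k = f k.+1 * (w + c k * alpha) + c k * beta + h k.+1]].
Proof.
(* [D] is the determinant of the two first-order conditions as a linear system in [alpha] and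
   [beta]. Eliminating [beta] gives [A1] and [A0]; the second condition solved for [beta] gives [B1]
   and [B0]. *)
pose D k (x : R * R * R * R) := let: (a, b, f, h) := x in
  g k * (1 + f) + a * (1 + c k) * (1 + g k).
pose A1 k (x : R * R * R * R) := let: (a, b, f, h) := x in
  - ((1 + g k) * a / D k x).
pose A0 k (x : R * R * R * R) := let: (a, b, f, h) := x in
  (g k * l - (1 + g k) * b) / D k x.
pose B1 k (x : R * R * R * R) := let: (a, b, f, h) := x in
  (g k - f) * A1 k x / (1 + g k).
pose B0 k (x : R * R * R * R) := let: (a, b, f, h) := x in
  (l + (g k - f) * A0 k x) / (1 + g k).
(* Coefficients of [w] and constants are matched in the last two identities of the statement. *)
pose step k (x : R * R * R * R) := let: (a, b, f, h) := x in
  (a * (1 + c k * A1 k x), a * c k * A0 k x + b,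
   f * (1 + c k * A1 k x) + c k * B1 k x,
   f * c k * A0 k x + c k * B0 k x + h).
have [x [xN xE]] := ex_backward (1, 0, 0, 0) step.
pose a k := (x k).1.1.1; pose b k := (x k).1.1.2.
pose f k := (x k).1.2; pose h k := (x k).2.
have xk k : x k = (a k, b k, f k, h k).
  by rewrite /a /b /f /h; case: (x k) => [[[? ?] ?] ?].
have stepE k : (k < N)%N -> [/\ a k = a k.+1 * (1 + c k * A1 k (x k.+1)),
    b k = a k.+1 * c k * A0 k (x k.+1) + b k.+1,
    f k = f k.+1 * (1 + c k * A1 k (x k.+1)) + c k * B1 k (x k.+1) &
    h k = f k.+1 * c k * A0 k (x k.+1) + c k * B0 k (x k.+1) + h k.+1].
  by move=> kN; rewrite [x k.+1]xk; move: (xE k kN); rewrite !xk => -[].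
(* [f] itself may become negative, so the induction carries [1 + f]. Both new values are rewritten
   below over the positive [D], with numerators that are visibly positive. *)
have pos k : (k <= N)%N -> 0 < a k /\ 0 < 1 + f k.
  move: k; apply: backward_ind => [|k kN [a0 f0]].
    by rewrite /a /f xN /= addr0.
  have [-> _ -> _] := stepE _ kN.
  have := g_ge0 kN; have := c_ge0 kN.
  rewrite /B1 /A1 /D xk.
  set a' := a k.+1 in a0 *; set f' := f k.+1 in f0 *.
  set c' := c k; set g' := g k => c0 g0.
  have g1 : 0 < 1 + g' by lra.
  have D0 : 0 < g' * (1 + f') + a' * (1 + c') * (1 + g').
    have := mulr_ge0 g0 (ltW f0); have := mulr_gt0 (mulr_gt0 a0 (ltr_pwDl ltr01 c0)) g1.
    lra.
  split.
    rewrite (_ : a' * _ = a' * (g' * (1 + f') + a' * (1 + g')) /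
        (g' * (1 + f') + a' * (1 + c') * (1 + g'))).
      rewrite divr_gt0// mulr_gt0//.
      have := mulr_ge0 g0 (ltW f0); have := mulr_gt0 a0 g1; lra.
    by field; rewrite ?gt_eqF.
  rewrite (_ : 1 + _ = (1 + f') * (g' * (1 + f') + a' * (1 + g') + a' * c') /
      (g' * (1 + f') + a' * (1 + c') * (1 + g'))).
    rewrite divr_gt0// mulr_gt0//.
    have := mulr_ge0 g0 (ltW f0); have := mulr_gt0 a0 g1; have := mulr_ge0 (ltW a0) c0; lra.
  by field; rewrite ?gt_eqF.
exists a, b, f, h, (fun k => A1 k (x k.+1)), (fun k => A0 k (x k.+1)),
  (fun k => B1 k (x k.+1)), (fun k => B0 k (x k.+1)).
split; [by rewrite /a xN|by rewrite /b xN|by rewrite /f xN|by rewrite /h xN|].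
split=> [k /pos[]//|k w kN alpha beta]; rewrite {}/beta {}/alpha.
have [-> -> -> ->] := stepE _ kN.
have [a0 f0] := pos _ kN.
have := g_ge0 kN; have := c_ge0 kN.
rewrite /B1 /B0 /A1 /A0 /D xk.
set a' := a k.+1 in a0 *; set f' := f k.+1 in f0 *; set b' := b k.+1.
set c' := c k; set g' := g k => c0 g0 /=.
have g1 : 0 < 1 + g' by lra.
have D0 : 0 < g' * (1 + f') + a' * (1 + c') * (1 + g').
  have := mulr_ge0 g0 (ltW f0); have := mulr_gt0 (mulr_gt0 a0 (ltr_pwDl ltr01 c0)) g1.
  lra.
by split; field; rewrite ?gt_eqF.
Qed.

End Feedback.

(** * Quadratic forms and their tangents *)

Section Quadratic.
Context {R : realType} {p : nat}.
Implicit Types (M : 'M[R]_p) (x y z : 'cV[R]_p).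

Lemma dotE x y : (x^T *m y) 0 0 = \sum_i y i 0 * x i 0.
Proof. by rewrite mxE; apply: eq_bigr => i _; rewrite mxE mulrC. Qed.

Lemma dotBr x y z :
  (x^T *m (y - z)) 0 0 = (x^T *m y) 0 0 - (x^T *m z) 0 0.
Proof. by rewrite mulmxBr [LHS]mxE [X in _ + X]mxE. Qed.

Lemma quadE M x : quad M x = \sum_i x i 0 * (M *m x) i 0.
Proof. by rewrite /quad -mulmxA mxE; apply: eq_bigr => i _; rewrite mxE. Qed.

(** The gap between the two sides is [quad M y]. *)
Lemma quad_tangent M x y : psd M ->
  quad M x + 2 * \sum_i y i 0 * (M *m x) i 0 <= quad M (x + y).
Proof.
move=> [MT M0]; rewrite -subr_ge0.
have yx : (y^T *m M *m x) 0 0 = \sum_i y i 0 * (M *m x) i 0.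
  by rewrite -mulmxA mxE; apply: eq_bigr => i _; rewrite mxE.
have xy : (x^T *m M *m y) 0 0 = (y^T *m M *m x) 0 0.
  by rewrite -[y^T *m M *m x]trmxK [RHS]mxE !trmx_mul trmxK MT mulmxA.
have add00 (A B : 'M[R]_1) : (A + B) 0 0 = A 0 0 + B 0 0 by rewrite mxE.
rewrite (_ : _ - _ = quad M y) ?M0// /quad [(x + y)^T]linearD/=.
rewrite !mulmxDl !mulmxDr.
by rewrite !add00 xy -yx; ring.
Qed.

End Quadratic.

(** * The filtration of past returns and independence of the present one *)

Section Filtration.
Context {R : realType} {d : measure_display} {T : measurableType d}.
Context (P : probability T R) {p N : nat} (s : nat -> R).
Context (e : nat -> T -> 'cV[R]_p).
Hypothesis e_L2 : forall k, (k < N)%N -> square_integrable_vec P (e k).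
Hypothesis e_indep : independent_vectors P N e.

Local Notation F := (Fm e).
Local Notation sig k := (sigma_of e [set (k : nat)]).
Local Notation Th := (Theta s e).

Let me l i : (l < N)%N -> measurable_fun [set: T] (fun w => e l w i 0).
Proof. by move=> lN; have /L2P[] := e_L2 lN i. Qed.

Lemma FmP k : sigma_algebra setT (F k). Proof. exact: sigma_ofP. Qed.

Lemma Fm_measurable k : (k <= N)%N -> F k `<=` measurable.
Proof.
by move=> kN; apply: sigma_of_measurable => l i lk; exact/me/(leq_trans lk).
Qed.

Lemma sig_measurable k : (k < N)%N -> sig k `<=` measurable.
Proof. by move=> kN; apply: sigma_of_measurable => _ i ->; exact: me. Qed.

Lemma L2G_sub (G G' : set (set T)) f : G `<=` G' -> L2G P G f -> L2G P G' f.
Proof. by move=> GG' [mf lf]; split => //; exact: subset_trans GG'. Qed.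

Lemma Fm_sub k k' : (k <= k')%N -> F k `<=` F k'.
Proof. by move=> kk'; apply: sigma_ofS => l /= lk; exact: leq_trans kk'. Qed.

Lemma L2G_Theta k i : (k < N)%N -> L2G P (sig k) (fun w => Th k w i 0).
Proof.
move=> kN; split; last exact: (L2_Theta s e_L2).
apply: (@eq_measurable_wrt _ _ _ _ (fun w => e k w i 0 - s k)).
  by move=> w; rewrite /Theta !mxE.
have sP := sigma_ofP e [set k].
have me_ki : measurable_wrt (sig k) (fun w => e k w i 0).
  exact: measurable_wrt_sigma_of.
exact: (measurable_wrtB sP me_ki (measurable_wrt_cst sP (s k))).
Qed.

Lemma independent_present k A B : (k < N)%N -> F k A -> sig k B ->
  P (A `&` B) = (P A * P B)%E.
Proof. by move=> kN; exact: (independent_past kN me e_indep). Qed.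

Lemma mean_present k f g : (k < N)%N ->
  measurable_wrt (F k) f -> L1 P f -> measurable_wrt (sig k) g -> L1 P g ->
  mean P (fun w => f w * g w) = mean P f * mean P g.
Proof.
move=> kN mf lf mg lg.
apply: (meanM_indep (FmP k) (Fm_measurable (ltnW kN)) (sigma_ofP e [set k])
  (sig_measurable kN)) => //.
by move=> A B; exact: independent_present.
Qed.

(** The squares of [f] and [g] are integrable and independent, so their product is integrable. *)
Lemma L2GM_present k f g : (k < N)%N -> L2G P (F k) f -> L2G P (sig k) g ->
  L2G P (F k.+1) (fun w => f w * g w).
Proof.
move=> kN [mf lf] [mg lg]; split.
  apply: measurable_wrtM; first exact: FmP.
    exact: subset_trans mf (Fm_sub _).
  by apply: subset_trans mg _; apply: sigma_ofS => _ ->; rewrite /= ltnS.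
split; first by apply: measurable_funM; [case: lf|case: lg].
apply: (@eq_L1 _ _ _ _ (fun w => (f w * f w) * (g w * g w))).
  by move=> w; ring.
apply: (L1M_indep (FmP k) (Fm_measurable (ltnW kN)) (sigma_ofP e [set k])
  (sig_measurable kN)) => //; try exact: L1M.
- by move=> A B; exact: independent_present.
- by apply: measurable_wrtM => //; exact: FmP.
- by apply: measurable_wrtM => //; exact: sigma_ofP.
Qed.

End Filtration.

(** * The self-coordination pair *)

Section Wealth.
Context {R : realType} {d : measure_display} {T : measurableType d}.
Context {p N : nat} (s : nat -> R) (e : nat -> T -> 'cV[R]_p).

Definition growth k : R := \prod_(k <= j < N) s j.

Lemma growthN : growth N = 1. Proof. by rewrite /growth big_geq. Qed.

Lemma growthE k : (k < N)%N -> growth k = s k * growth k.+1.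
Proof. by move=> kN; rewrite /growth big_ltn. Qed.

Lemma growth_gt0 k : (forall j, (j < N)%N -> 1 < s j) -> 0 < growth k.
Proof.
move=> s1; rewrite /growth big_nat_cond; apply: prodr_gt0 => j /andP[/andP[_ jN] _].
exact: lt_trans (s1 j jN).
Qed.

(** Compounded to the horizon, riskless growth disappears and wealth changes only by trading
    gains. *)
Lemma growth_wealth k j x u w : (k <= j <= N)%N ->
  growth j * wealth s e k x u j w = growth k * x w +
    \sum_(k <= i < j) growth i.+1 * ((Theta s e i w)^T *m u i w) 0 0.
Proof.
move=> /andP[kj jN]; rewrite /wealth; have := jN; rewrite -{1 2 4}(subnKC kj).
elim: (j - k)%N => [|n ih] knN; first by rewrite addn0 big_geq// addr0.
rewrite addnS in knN *; rewrite big_nat_recr ?leq_addr//= addrA -ih; last exact: ltnW.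
by rewrite mulrDr mulrA [growth (k + n)]growthE// (mulrC (s _)).
Qed.

End Wealth.

(** * Construction of the pair and its optimality *)

Section Coordination.
Context {R : realType} {d : measure_display} {T : measurableType d}.
Context (P : probability T R) {p N : nat} (s : nat -> R).
Context (e : nat -> T -> 'cV[R]_p) (lambda : R) (mu : nat -> R) (Phi : nat -> 'M[R]_p).
Hypothesis s_gt1 : forall k, (k < N)%N -> 1 < s k.
Hypothesis e_L2 : forall k, (k < N)%N -> square_integrable_vec P (e k).
Hypothesis e_indep : independent_vectors P N e.
Hypothesis mu_ge0 : forall k, (k < N)%N -> 0 <= mu k.
Hypothesis Phi_psd : forall k, (k < N)%N -> psd (Phi k).

Local Notation F := (Fm e).
Local Notation sig k := (sigma_of e [set (k : nat)]).
Local Notation Th := (Theta s e).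
Local Notation m k := (mean_vec P (Th k)).
Local Notation S := (growth (N := N) s).

Variables (y : nat -> 'cV[R]_p) (gm : nat -> R).
Hypothesis Cy : forall k, (k < N)%N -> cov_mx P (Th k) *m y k = m k.
Hypothesis Phi_y : forall k, (k < N)%N -> mu k *: (Phi k *m y k) = gm k *: m k.

Definition excess k w : R := ((Th k w)^T *m y k) 0 0.
Definition excess_mean k : R := ((m k)^T *m y k) 0 0.
Local Notation xi := excess.
Local Notation c := excess_mean.

Variables a b f h alpha1 alpha0 beta1 beta0 : nat -> R.
Hypotheses (aN : a N = 1) (bN : b N = 0) (fN : f N = 0) (hN : h N = 0).
Hypothesis a_gt0 : forall k, (k <= N)%N -> 0 < a k.
(** One factor [S k.+1] under [gm k] comes from scaling the controls, the other from factoring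
    [S k.+1] times the mean out of the gradient. *)
Hypothesis feedback : forall k w, (k < N)%N ->
  let alpha := alpha1 k * w + alpha0 k in
  let beta := beta1 k * w + beta0 k in
  let g := gm k / S k.+1 ^+ 2 in
  [/\ g * (alpha - beta) + a k.+1 * (w + (1 + c k) * alpha) + b k.+1 = 0,
      g * (beta - alpha) + beta + f k.+1 * alpha - lambda / 2 = 0,
      a k * w + b k = a k.+1 * (w + c k * alpha) + b k.+1 &
      f k * w + h k = f k.+1 * (w + c k * alpha) + c k * beta + h k.+1].

Variables (t : nat) (z : T -> R).
Hypotheses (tN : (t < N)%N) (zF : L2G P (F t) z).

(** The root of [a t * w + b t = - (lambda / 2)]: with this start the projected final state has the
    value that makes E_t X_N consistent with its use in the state. *)
Definition omega : R := - (lambda / 2 + b t) / a t.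

(** Constant up to and including time [t], so that the recursion on [nat] starts at [t] without
    shifting indices. *)
Fixpoint state k : T -> R :=
  if k is k'.+1 then
    if (k' < t)%N then cst omega
    else fun w => state k' w + xi k' w * (alpha1 k' * state k' w + alpha0 k')
  else cst omega.

Definition alpha k w := alpha1 k * state k w + alpha0 k.
Definition beta k w := beta1 k * state k w + beta0 k.
(** The scaling makes the compounded gain exactly [xi k * alpha k]; the direction [y k] makes the
    penalty gradient a multiple of the mean. *)
Definition u_opt k w : 'cV[R]_p := (alpha k w / S k.+1) *: y k.
Definition v_opt k w : 'cV[R]_p := (beta k w / S k.+1) *: y k.

Lemma stateS k w : (t <= k)%N -> state k.+1 w = state k w + xi k w * alpha k w.
Proof. by move=> tk; rewrite /= ltnNge tk. Qed.

Lemma state_before k w : (k <= t)%N -> state k w = omega.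
Proof. by case: k => //= k ->. Qed.

Let Th2 k (kN : (k < N)%N) i : L2 P (fun w => Th k w i 0).
Proof. exact: (L2_Theta s e_L2). Qed.

Lemma L2G_excess k : (k < N)%N -> L2G P (sig k) (xi k).
Proof.
move=> kN; apply: (@eq_L2G _ _ _ _ _ (fun w => \sum_i y k i 0 * Th k w i 0)).
  by move=> w; rewrite /excess dotE.
apply: (L2G_sum (sigma_ofP e _)) => i _; apply: L2GZ; first exact: sigma_ofP.
exact: (L2G_Theta s e_L2).
Qed.

Lemma L2G_affine k x a1 a0 : L2G P (F k) x -> L2G P (F k) (fun w => a1 * x w + a0).
Proof.
move=> lx; apply: L2GD; [exact: FmP|apply: L2GZ => //; exact: FmP|].
exact: (L2G_cst P (FmP e k) a0).
Qed.

Lemma L2G_state k : (k <= N)%N -> L2G P (F k) (state k).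
Proof.
elim: k => [|k ih] kN; first exact: (L2G_cst P (FmP e 0) omega).
have lk := ih (ltnW kN) => /=; case: ifP => _; first exact: (L2G_cst P (FmP e k.+1) omega).
apply: L2GD; [exact: FmP|by apply: L2G_sub lk; exact: Fm_sub|].
apply: (@eq_L2G _ _ _ _ _ (fun w => alpha k w * xi k w)).
  by move=> w; rewrite mulrC.
by apply: (L2GM_present e_L2 e_indep kN); [exact: L2G_affine|exact: L2G_excess].
Qed.

Lemma L2G_alpha k : (k <= N)%N -> L2G P (F k) (alpha k).
Proof. by move=> kN; exact/L2G_affine/L2G_state. Qed.

Lemma L2G_beta k : (k <= N)%N -> L2G P (F k) (beta k).
Proof. by move=> kN; exact/L2G_affine/L2G_state. Qed.

Lemma l2E k x : l2 P e k x <-> L2G P (F k) x.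
Proof. by split=> -[mx lx]; split => //; exact/L2P. Qed.

Lemma u_opt_admissible : admissible P N e t u_opt.
Proof.
move=> k /andP[_ kN] i; apply/l2E.
apply: (@eq_L2G _ _ _ _ _ (fun w => (y k i 0 / S k.+1) * alpha k w)).
  by move=> w; rewrite mxE; ring.
by apply: L2GZ; [exact: FmP|exact: L2G_alpha (ltnW kN)].
Qed.

Lemma v_opt_admissible : admissible P N e t v_opt.
Proof.
move=> k /andP[_ kN] i; apply/l2E.
apply: (@eq_L2G _ _ _ _ _ (fun w => (y k i 0 / S k.+1) * beta k w)).
  by move=> w; rewrite mxE; ring.
by apply: L2GZ; [exact: FmP|exact: L2G_beta (ltnW kN)].
Qed.

(** Each increment is a centred excess return, independent of the past, times a variable known
    before it; its product with [Z] factors and the centred factor has mean zero. *)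
Lemma mean_martingale (r gam : nat -> T -> R) k j : (k <= j <= N)%N ->
  (forall i, (k <= i <= N)%N -> L2G P (F i) (r i)) ->
  (forall i, (k <= i < N)%N -> L2G P (F i) (gam i)) ->
  (forall i w, (k <= i < N)%N -> r i.+1 w = r i w + (xi i w - c i) * gam i w) ->
  forall Z, L2G P (F k) Z -> mean P (fun w => Z w * (r j w - r k w)) = 0.
Proof.
move=> /andP[kj jN] lr lgam rE Z lZ.
rewrite -(subnKC kj) in jN *; elim: (j - k)%N jN => [|n ih] knN.
  by rewrite addn0 -[RHS](mean_cst P); apply: eq_mean => w; rewrite subrr mulr0.
rewrite addnS in knN *; have kn := leq_addr n k.
have kin : (k <= k + n < N)%N by rewrite kn.
have lrn := lr (k + n)%N; rewrite kn (ltnW knN) in lrn; have {}lrn := lrn isT.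
have lrk := lr k; rewrite leqnn (leq_trans kn (ltnW knN)) in lrk; have {}lrk := lrk isT.
have lgn := lgam _ kin.
have lZn : L2G P (F (k + n)) Z by apply: L2G_sub lZ; exact: Fm_sub.
rewrite (@eq_mean _ _ _ _ _ (fun w => Z w * (r (k + n)%N w - r k w) +
    (Z w * gam (k + n)%N w) * (xi (k + n) w - c (k + n)))); last first.
  by move=> w; rewrite rE//; ring.
have lx := L2G_excess knN.
have lxc : L1 P (fun w => xi (k + n) w - c (k + n)).
  by apply: L1B (L1_cst P _); exact: L2_L1 lx.2.
have lrB : L2G P (F (k + n)) (fun w => r (k + n)%N w - r k w).
  by apply: L2GB => //; [exact: FmP|apply: L2G_sub lrk; exact: Fm_sub].
have mxc : measurable_wrt (sig (k + n)) (fun w => xi (k + n) w - c (k + n)).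
  have sP := sigma_ofP e [set (k + n)%N].
  exact: (measurable_wrtB sP lx.1 (measurable_wrt_cst sP (c (k + n)))).
have mZg := measurable_wrtM (FmP e (k + n)) lZn.1 lgn.1.
have lZg := L1M lZn.2 lgn.2.
rewrite meanD; first last.
- apply: (L1M_indep (FmP e (k + n)) _ (sigma_ofP e [set (k + n)%N])) => //.
  + exact: (Fm_measurable e_L2 (ltnW knN)).
  + exact: (sig_measurable e_L2 knN).
  + by move=> A B; exact: (independent_present e_L2 e_indep knN).
- exact: L1M lZn.2 lrB.2.
rewrite ih ?(ltnW knN)// add0r (mean_present e_L2 e_indep knN)//.
rewrite (meanB (L2_L1 lx.2) (L1_cst P _)) mean_cst.
by rewrite (mean_dot (fun i => Th2 knN i)) subrr mulr0.
Qed.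


Lemma mean_mul_Theta k i Z : (k < N)%N -> measurable_wrt (F k) Z -> L1 P Z ->
  mean P (fun w => Z w * Th k w i 0) = mean P Z * m k i 0.
Proof.
move=> kN mZ lZ; have lTh := L2G_Theta s e_L2 i kN.
by rewrite (mean_present e_L2 e_indep kN) ?mean_vecE//; [exact: lTh.1|exact: L2_L1 lTh.2].
Qed.

(** [r N] may be replaced by [r k.+1], whose increment from [r k] is [(xi k - c k) * gam k]. Since
    [Theta_k * (xi k - c k)] averages to the mean of [Theta_k], what remains is [Z] times the
    vanishing expression. [kappa] stands for the penalty gradient; [rho] is [r k] for one player and
    [- (lambda / 2)] for the other. *)
Lemma mean_first_order (r gam : nat -> T -> R) (rho kappa : T -> R) k i :
  (k < N)%N ->
  (forall j, (k <= j <= N)%N -> L2G P (F j) (r j)) ->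
  (forall j, (k <= j < N)%N -> L2G P (F j) (gam j)) ->
  (forall j w, (k <= j < N)%N -> r j.+1 w = r j w + (xi j w - c j) * gam j w) ->
  L2G P (F k) rho -> L2G P (F k) kappa ->
  (forall w, kappa w + S k.+1 * m k i 0 * (gam k w + rho w) = 0) ->
  forall Z, L2G P (F k) Z ->
  L1 P (fun w => Z w * (kappa w + S k.+1 * Th k w i 0 * (r N w - r k w + rho w))) /\
  mean P (fun w => Z w * (kappa w + S k.+1 * Th k w i 0 * (r N w - r k w + rho w)))
  = 0.
Proof.
move=> kN lr lgam rE lrho lkappa foc Z lZ.
have lTh := L2G_Theta s e_L2 i kN; have lx := L2G_excess kN.
have lrN : L2 P (r N) by have [] := lr N; rewrite ?leqnn ?(ltnW kN).
have lrk : L2G P (F k) (r k) by apply: lr; rewrite leqnn ltnW.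
have lrk1 : L2 P (r k.+1) by have [] := lr k.+1; rewrite ?leqnSn ?kN.
have lg : L2G P (F k) (gam k) by apply: lgam; rewrite leqnn.
have rEk w : r k.+1 w = r k w + (xi k w - c k) * gam k w by apply: rE; rewrite leqnn.
have lZTh : L2G P (F k.+1) (fun w => Z w * Th k w i 0).
  exact: (L2GM_present e_L2 e_indep kN).
(* The martingale is started at [k.+1], as the test variable now contains [Theta_k]. *)
have mart : mean P (fun w => (Z w * Th k w i 0) * (r N w - r k.+1 w)) = 0.
  apply: (mean_martingale (gam := gam)) lZTh; first by rewrite kN leqnn.
  - by move=> j /andP[kj jN]; apply: lr; rewrite jN (ltnW kj).
  - by move=> j /andP[kj jN]; apply: lgam; rewrite jN (ltnW kj).
  - by move=> j w /andP[kj jN]; apply: rE; rewrite jN (ltnW kj).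
(* The two contributions are [(1 + c k)] and [- c k] times the mean. *)
have mTx : mean P (fun w => Th k w i 0 * (xi k w - c k)) = m k i 0.
  rewrite (@eq_mean _ _ _ _ _ (fun w => Th k w i 0 * xi k w - c k * Th k w i 0)); last first.
    by move=> w; ring.
  have lT1 := L2_L1 lTh.2.
  rewrite (meanB (L1M lTh.2 lx.2) (L1Z (c k) lT1)) meanZ//.
  rewrite (mean_mul_dot (fun i => Th2 kN i) (Cy kN)) -mean_vecE -/(c k).
  by ring.
have sP := sigma_ofP e [set k].
have lxc : L2G P (sig k) (fun w => xi k w - c k).
  by apply: L2GB => //; exact: (L2G_cst P sP (c k)).
have lgr : L2G P (F k) (fun w => gam k w + rho w) by apply: L2GD => //; exact: FmP.
pose t1 w := Z w * kappa w.
pose t2 w := S k.+1 * ((Z w * Th k w i 0) * (r N w - r k.+1 w)).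
pose t3 w := S k.+1 * ((Z w * gam k w) * (Th k w i 0 * (xi k w - c k))).
pose t4 w := S k.+1 * ((Z w * rho w) * Th k w i 0).
have l1 : L1 P t1 by exact: L1M lZ.2 lkappa.2.
have l2 : L1 P t2 by apply: L1Z; apply: L1M lZTh.2 _; exact: L2B.
have lZg := L1M lZ.2 lg.2; have mZg := measurable_wrtM (FmP e k) lZ.1 lg.1.
have lZr := L1M lZ.2 lrho.2; have mZr := measurable_wrtM (FmP e k) lZ.1 lrho.1.
have mTc := measurable_wrtM sP lTh.1 lxc.1; have lTc := L1M lTh.2 lxc.2.
have L1I f1 f2 : measurable_wrt (F k) f1 -> measurable_wrt (sig k) f2 ->
    L1 P f1 -> L1 P f2 -> L1 P (fun w => f1 w * f2 w).
  apply: (L1M_indep (FmP e k) (Fm_measurable e_L2 (ltnW kN)) sP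
    (sig_measurable e_L2 kN)).
  by move=> A B; exact: (independent_present e_L2 e_indep kN).
have l3 : L1 P t3 by apply: L1Z; exact: L1I.
have l4 : L1 P t4 by apply: L1Z; apply: L1I => //; [exact: lTh.1|exact: L2_L1 lTh.2].
have tE w : t1 w + t2 w + t3 w + t4 w =
    Z w * (kappa w + S k.+1 * Th k w i 0 * (r N w - r k w + rho w)).
  by rewrite /t1 /t2 /t3 /t4 rEk; ring.
split; first by apply: eq_L1 tE _; exact: L1D (L1D (L1D l1 l2) l3) l4.
rewrite -(eq_mean P tE) (meanD (L1D (L1D l1 l2) l3) l4) (meanD (L1D l1 l2) l3) (meanD l1 l2).
rewrite /t2 meanZ ?mart; last by apply: L1M lZTh.2 _; exact: L2B.
rewrite /t3 meanZ; last exact: L1I.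
rewrite (mean_present e_L2 e_indep kN)// mTx.
rewrite /t4 meanZ; last by apply: L1I => //; [exact: lTh.1|exact: L2_L1 lTh.2].
rewrite mean_mul_Theta// mulr0 addr0.
have -> : mean P t1 = - (S k.+1 * m k i 0) * mean P (fun w => Z w * gam k w + Z w * rho w).
  rewrite -meanZ; last exact: L1D.
  apply: eq_mean => w; rewrite /t1; have /eqP := foc w.
  by rewrite addr_eq0 => /eqP ->; ring.
by rewrite meanD//; ring.
Qed.

Lemma mean_first_order_dot (r gam : nat -> T -> R) (rho : T -> R) (K x : T -> 'cV[R]_p) k A :
  (k < N)%N ->
  (forall j, (k <= j <= N)%N -> L2G P (F j) (r j)) ->
  (forall j, (k <= j < N)%N -> L2G P (F j) (gam j)) ->
  (forall j w, (k <= j < N)%N -> r j.+1 w = r j w + (xi j w - c j) * gam j w) ->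
  L2G P (F k) rho -> (forall i, L2G P (F k) (fun w => K w i 0)) ->
  (forall i w, K w i 0 + S k.+1 * m k i 0 * (gam k w + rho w) = 0) ->
  (forall i, L2G P (F k) (fun w => x w i 0)) -> F k A ->
  let D w := \1_A w * \sum_i x w i 0 *
    (K w i 0 + S k.+1 * Th k w i 0 * (r N w - r k w + rho w)) in
  L1 P D /\ mean P D = 0.
Proof.
move=> kN lr lgam rE lrho lK foc lx FA D.
have DE w : \sum_i (\1_A w * x w i 0) *
    (K w i 0 + S k.+1 * Th k w i 0 * (r N w - r k w + rho w)) = D w.
  by rewrite /D mulr_sumr; apply: eq_bigr => i _; rewrite mulrA.
have term i := mean_first_order kN lr lgam rE lrho (lK i) (foc i)
  (L2G_indicM (FmP e k) (Fm_measurable e_L2 (ltnW kN)) FA (lx i)).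
split; first by apply: eq_L1 DE _; apply: L1_sum => i _; case: (term i).
rewrite -(eq_mean P DE) mean_sum => [|i _]; last by case: (term i).
by rewrite big1// => i _; case: (term i).
Qed.

Let S_gt0 k : 0 < S k. Proof. exact: growth_gt0. Qed.
Let S_neq0 k : S k != 0. Proof. by rewrite gt_eqF. Qed.

Lemma gain_u_opt k w : S k.+1 * ((Th k w)^T *m u_opt k w) 0 0 = xi k w * alpha k w.
Proof. by rewrite -scalemxAr mxE -/(xi k w); field; exact: S_neq0. Qed.

Lemma gain_v_opt k w : S k.+1 * ((Th k w)^T *m v_opt k w) 0 0 = xi k w * beta k w.
Proof. by rewrite -scalemxAr mxE -/(xi k w); field; exact: S_neq0. Qed.

Lemma state_sum k w : (t <= k)%N ->
  state k w = omega + \sum_(t <= i < k) xi i w * alpha i w.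
Proof.
move=> tk; rewrite -(subnKC tk); elim: (k - t)%N => [|n ih].
  by rewrite addn0 big_geq// addr0 state_before.
by rewrite addnS stateS ?leq_addr// ih big_nat_recr ?leq_addr//= addrA.
Qed.

(** The conditional mean of X_N under [u_opt]: compounded gains sum to [state N - omega], of
    conditional mean [- lambda / 2 - omega]. *)
Definition final_mean (w : T) := S t * z w - omega - lambda / 2.

Lemma wealth_u_opt w : wealth s e t z u_opt N w = final_mean w + (state N w + lambda / 2).
Proof.
have := @growth_wealth _ _ _ _ N s e t N z u_opt w.
rewrite leqnn (ltnW tN) growthN mul1r => -> //.
rewrite (eq_bigr _ (fun i _ => gain_u_opt i w)) (state_sum _ (ltnW tN)) /final_mean.
by ring.
Qed.

Lemma L2_gain k (x : T -> 'cV[R]_p) : (k < N)%N ->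
  (forall i, L2G P (F k) (fun w => x w i 0)) ->
  L2G P (F k.+1) (fun w => S k.+1 * ((Th k w)^T *m x w) 0 0).
Proof.
move=> kN lx; apply: L2GZ; first exact: FmP.
apply: (@eq_L2G _ _ _ _ _ (fun w => \sum_i x w i 0 * Th k w i 0)).
  by move=> w; rewrite dotE.
apply: L2G_sum => [|i _]; first exact: FmP.
by apply: (L2GM_present e_L2 e_indep kN) (lx i) _; exact: (L2G_Theta s e_L2).
Qed.

Lemma admissible_L2G u k i : admissible P N e t u -> (t <= k < N)%N ->
  L2G P (F k) (fun w => u k w i 0).
Proof. by move=> au tk; apply/l2E; exact: au. Qed.

Lemma L2G_subv k (u v : T -> 'cV[R]_p) :
  (forall i, L2G P (F k) (fun w => u w i 0)) ->
  (forall i, L2G P (F k) (fun w => v w i 0)) ->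
  forall i, L2G P (F k) (fun w => (u w - v w) i 0).
Proof.
move=> lu lv i; apply: (@eq_L2G _ _ _ _ _ (fun w => u w i 0 - v w i 0)).
  by move=> w; rewrite !mxE.
by apply: L2GB => //; exact: FmP.
Qed.

Lemma measurable_quad k (M : 'M[R]_p) (x : T -> 'cV[R]_p) :
  (forall i, L2G P (F k) (fun w => x w i 0)) ->
  measurable_wrt (F k) (fun w => quad M (x w)) /\ L1 P (fun w => quad M (x w)).
Proof.
move=> lx.
have lMx i : L2G P (F k) (fun w => (M *m x w) i 0).
  apply: (@eq_L2G _ _ _ _ _ (fun w => \sum_j M i j * x w j 0)).
    by move=> w; rewrite mxE.
  by apply: L2G_sum => [|j _]; [exact: FmP|apply: L2GZ => //; exact: FmP].
have qE w : \sum_i x w i 0 * (M *m x w) i 0 = quad M (x w) by rewrite quadE.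
split.
  apply: eq_measurable_wrt qE _; apply: measurable_wrt_sum => [|i _]; first exact: FmP.
  by apply: measurable_wrtM; [exact: FmP|case: (lx i)|case: (lMx i)].
apply: eq_L1 qE _; apply: L1_sum => i _.
by apply: L1M; [case: (lx i)|case: (lMx i)].
Qed.

Lemma penalty_gradient k w : (k < N)%N ->
  mu k *: (Phi k *m (u_opt k w - v_opt k w)) =
  ((alpha k w - beta k w) / S k.+1 * gm k) *: m k.
Proof.
move=> kN; rewrite /u_opt /v_opt -scalerBl -mulrBl -scalemxAr scalerA [mu k * _]mulrC.
by rewrite -[LHS]scalerA Phi_y// scalerA.
Qed.

Lemma penalty_convex k (x x' : 'cV[R]_p) : (k < N)%N ->
  mu k * quad (Phi k) x + 2 * \sum_i (x' - x) i 0 * (mu k *: (Phi k *m x)) i 0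
  <= mu k * quad (Phi k) x'.
Proof.
move=> kN; have := quad_tangent x (x' - x) (Phi_psd kN); rewrite subrKC.
move=> /(ler_wpM2l (mu_ge0 kN)); apply: le_trans.
rewrite mulrDr lerD2l mulrCA ler_pM2l// mulr_sumr le_eqVlt; apply/orP; left; apply/eqP.
by apply: eq_bigr => i _; rewrite [X in _ * X = _]mxE; ring.
Qed.

Definition penalty (u : control (T := T)) w : R :=
  \sum_(t <= k < N) mu k * quad (Phi k) (u k w - v_opt k w).

Lemma penalty_term u k : admissible P N e t u -> (t <= k < N)%N ->
  L1 P (fun w => mu k * quad (Phi k) (u k w - v_opt k w)).
Proof.
move=> au tk; apply: L1Z; apply: (measurable_quad (k := k) _ _).2.
by apply: L2G_subv => i; apply: admissible_L2G => //; exact: v_opt_admissible.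
Qed.

Lemma penalty_is_condE u : admissible P N e t u ->
  L1 P (penalty u) /\ is_condE P (F t) (penalty u) (fun w => \sum_(t <= k < N)
    condE P (F t) (fun w' => mu k * quad (Phi k) (u k w' - v_opt k w')) w).
Proof.
move=> au; have Ft := FmP e t; have Fm := Fm_measurable e_L2 (ltnW tN).
(* Repeating the range as a predicate makes [t <= k < N] available in each summand, where
   integrability needs it. *)
have pE : penalty u = fun w => \sum_(t <= k < N | (t <= k < N)%N)
    mu k * quad (Phi k) (u k w - v_opt k w).
  by apply/funext => w; rewrite /penalty big_nat.
have -> : (fun w => \sum_(t <= k < N)
    condE P (F t) (fun w' => mu k * quad (Phi k) (u k w' - v_opt k w')) w) =
  (fun w => \sum_(t <= k < N | (t <= k < N)%N)
    condE P (F t) (fun w' => mu k * quad (Phi k) (u k w' - v_opt k w')) w).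
  by apply/funext => w; rewrite big_nat.
rewrite pE; split; first by apply: L1_sum => k tk; exact: penalty_term.
apply: (is_condE_sum Ft Fm) => k tk; first exact: penalty_term.
by apply: is_condE_condE => //; exact: penalty_term.
Qed.

Lemma L2G_final_mean : L2G P (F t) final_mean.
Proof.
have Ft := FmP e t; rewrite /final_mean.
by do 2 (apply: L2GB => //; last exact: (L2G_cst P Ft)); exact: L2GZ.
Qed.

(** The martingale closed by [state N]; [gam] is its coefficient on the centred excess return. *)
Let r k w := a k * state k w + b k.
Let gam k w := a k.+1 * alpha k w.

Let lr k : (k <= N)%N -> L2G P (F k) (r k).
Proof. by move=> kN; exact/L2G_affine/L2G_state. Qed.

Let lgam k : (t <= k < N)%N -> L2G P (F k) (gam k).
Proof.
by move=> /andP[_ kN]; apply: L2GZ; [exact: FmP|exact/L2G_alpha/ltnW].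
Qed.

Let rE k w : (t <= k < N)%N -> r k.+1 w = r k w + (xi k w - c k) * gam k w.
Proof.
move=> /andP[tk kN]; have [_ _ + _] := feedback (state k w) kN.
by rewrite /r /gam stateS// -/(alpha k w) => ->; ring.
Qed.

Lemma state_end_mean Z : L2G P (F t) Z ->
  mean P (fun w => Z w * (state N w + lambda / 2)) = 0.
Proof.
move=> lZ; rewrite (@eq_mean _ _ _ _ _ (fun w => Z w * (r N w - r t w))).
  apply: (mean_martingale (gam := gam)) lZ => //; first by rewrite leqnn ltnW.
  by move=> i /andP[_ iN]; exact: lr.
move=> w; rewrite /r aN bN (state_before w (leqnn t)) /omega.
by field; rewrite gt_eqF// a_gt0// ltnW.
Qed.

(** A deviation changes terminal wealth by a sum of compounded gains, one for each time. At each
    time the gradient is orthogonal to the deviation, by the first condition in [feedback], and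
    convexity of the penalty does the rest. *)
Lemma u_opt_optimal u' : admissible P N e t u' ->
  {ae P, forall w, Jhat P N s e lambda mu Phi t z u_opt v_opt w <=
                   Jhat P N s e lambda mu Phi t z u' v_opt w}.
Proof.
move=> au'; have Ft := FmP e t; have Fm := Fm_measurable e_L2 (ltnW tN).
have [lQ HQ] := penalty_is_condE u_opt_admissible.
have [lQ' HQ'] := penalty_is_condE au'.
pose X := wealth s e t z u_opt N; pose X' := wealth s e t z u' N.
pose dx k w := u' k w - u_opt k w.
have ldx k i : (t <= k < N)%N -> L2G P (F k) (fun w => dx k w i 0).
  move=> tk; apply: L2G_subv => j; apply: admissible_L2G => //.
  exact: u_opt_admissible.
have XX' w : X' w - X w = \sum_(t <= k < N) S k.+1 * ((Th k w)^T *m dx k w) 0 0.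
  have := @growth_wealth _ _ _ _ N s e t N z u' w.
  have := @growth_wealth _ _ _ _ N s e t N z u_opt w.
  rewrite leqnn (ltnW tN) growthN !mul1r /X /X' => -> // -> //.
  rewrite opprD addrACA subrr add0r -sumrB; apply: eq_bigr => k _.
  by rewrite /dx dotBr mulrBr.
have XM w : X w - final_mean w = state N w + lambda / 2.
  by rewrite /X wealth_u_opt addrC addKr.
have lX : L2 P X.
  apply: (@eq_L2 _ _ _ _ (fun w => final_mean w + (state N w + lambda / 2))).
    by move=> w; rewrite -wealth_u_opt.
  apply: L2D; first by case: L2G_final_mean.
  by apply: L2D; [case: (L2G_state (leqnn N))|exact: L2_cst].
have lX' : L2 P X'.
  apply: (@eq_L2 _ _ _ _ (fun w => X w + \sum_(t <= k < N | (t <= k < N)%N)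
     S k.+1 * ((Th k w)^T *m dx k w) 0 0)).
    by move=> w; rewrite -big_nat -XX' subrKC.
  apply: L2D => //; apply: L2_sum => k tk; have /andP[_ kN] := tk.
  by have [] := L2_gain kN (fun i => ldx k i tk).
have opt A : F t A -> 0 <= mean P (fun w => \1_A w * (penalty u' w - penalty u_opt w +
    (2 * (X w - final_mean w) - lambda) * (X' w - X w))).
  move=> FA; have mA := Fm _ FA.
  pose K k w := mu k *: (Phi k *m (u_opt k w - v_opt k w)).
  pose D k w := \1_A w * \sum_i dx k w i 0 *
    (K k w i 0 + S k.+1 * Th k w i 0 * (r N w - r k w + r k w)).
  have DP k : (t <= k < N)%N -> L1 P (D k) /\ mean P (D k) = 0.
    move=> /[dup] tk /andP[tk' kN].
    apply: (@mean_first_order_dot r gam) => //.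
    - by move=> j /andP[_ jN]; exact: lr.
    - by move=> j /andP[kj jN]; apply: lgam; rewrite jN (leq_trans tk' kj).
    - by move=> j w /andP[kj jN]; apply: rE; rewrite jN (leq_trans tk' kj).
    - exact/lr/ltnW.
    - move=> i; apply: (@eq_L2G _ _ _ _ _ (fun w =>
          (gm k * m k i 0 / S k.+1) * (alpha k w - beta k w))).
        by move=> w; rewrite /K penalty_gradient// [RHS]mxE; ring.
      apply: L2GZ; first exact: FmP.
      by apply: L2GB; [exact: FmP|exact/L2G_alpha/ltnW|exact/L2G_beta/ltnW].
    - move=> i w; rewrite /K penalty_gradient// [X in X + _]mxE /gam /r.
      have [+ _ + _] := feedback (state k w) kN.
      rewrite -/(alpha k w) -/(beta k w) => foc ->.
      transitivity (S k.+1 * m k i 0 * (gm k / S k.+1 ^+ 2 *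
        (alpha k w - beta k w) + a k.+1 * (state k w + (1 + c k) * alpha k w) +
        b k.+1)); last by rewrite foc mulr0.
      by field; exact: S_neq0.
    - by move=> i; exact: ldx.
    - by apply: Fm_sub FA.
  (* [E] is the linear part of the increment: its mean is zero, and it lies pointwise below the
     increment by the tangent inequality of the penalty. *)
  pose E w := 2 * \sum_(t <= k < N | (t <= k < N)%N) D k w.
  have lE : L1 P E by apply: L1Z; apply: L1_sum => k /DP[].
  have <- : mean P E = 0.
    rewrite meanZ; last by apply: L1_sum => k /DP[].
    by rewrite mean_sum => [|k /DP[]//]; rewrite big1 ?mulr0// => k /DP[].
  apply: le_mean => //.
    apply: L1_indicM => //; apply: L1D; first exact: L1B.
    apply: L1M; last exact: L2B.
    apply: L2B (L2_cst P lambda); apply: L2Z; apply: L2B => //.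
    by case: L2G_final_mean.
  move=> w; rewrite /E -big_nat mulr_sumr.
  rewrite (eq_bigr (fun k => \1_A w * (2 * \sum_i dx k w i 0 *
      (K k w i 0 + S k.+1 * Th k w i 0 * state N w)))); last first.
    move=> k _; rewrite /D mulrCA; congr (_ * (_ * _)); apply: eq_bigr => i _.
    by rewrite subrK /r aN bN mul1r addr0.
  rewrite -mulr_sumr; apply: ler_wpM2l; first by rewrite indicE.
  (* The shift by [lambda / 2] in the state absorbs the linear term of the objective. *)
  rewrite XM XX' (_ : 2 * _ - _ = 2 * state N w); last by field.
  rewrite /penalty -sumrB mulr_sumr -big_split/= big_nat [leRHS]big_nat.
  apply: ler_sum => k /andP[_ kN].
  have := penalty_convex (u_opt k w - v_opt k w) (u' k w - v_opt k w) kN.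
  rewrite (_ : u' k w - _ - _ = dx k w); last by rewrite opprB addrA subrK.
  have -> : 2 * (\sum_i dx k w i 0 * (K k w i 0 + S k.+1 * Th k w i 0 * state N w)) =
      2 * (\sum_i dx k w i 0 * K k w i 0) +
      2 * state N w * (S k.+1 * ((Th k w)^T *m dx k w) 0 0).
    by rewrite dotE !mulr_sumr -big_split/=; apply: eq_bigr => i _; ring.
  by rewrite lerD2r lerBrDl.
apply: (ae_le_mean_variance Ft Fm (lambda := lambda) lX lX' L2G_final_mean _
  lQ lQ' HQ HQ' opt).
move=> Z lZ; rewrite -(state_end_mean lZ).
by apply: eq_mean => w; rewrite -XM.
Qed.

(** [Y k] is the compounded wealth under [v_opt]. Adding the expected remaining gains
    [f k * state k + h k] gives [q k], the projected terminal wealth, a martingale with coefficient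
    [gamq]. *)
Let Y k w := S t * z w + \sum_(t <= i < k) xi i w * beta i w.
Let q k w := Y k w + f k * state k w + h k.
Let gamq k w := beta k w + f k.+1 * alpha k w.

Lemma growth_wealth_v_opt k w : (t <= k <= N)%N ->
  S k * wealth s e t z v_opt k w = Y k w.
Proof.
move=> tk; rewrite (growth_wealth _ _ _ _ _ tk); congr (_ + _).
by apply: eq_bigr => i _; exact: gain_v_opt.
Qed.

Let lq k : (t <= k <= N)%N -> L2G P (F k) (q k).
Proof.
move=> /andP[tk kN]; have Fk := FmP e k.
apply: L2GD => //; last exact: (L2G_cst P Fk).
apply: L2GD => //; last by apply: L2GZ => //; exact: L2G_state.
apply: L2GD => //.
  by apply: L2GZ => //; apply: L2G_sub zF; exact: Fm_sub.
apply: (@eq_L2G _ _ _ _ _ (fun w => \sum_(t <= i < k | (t <= i < k)%N)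
    xi i w * beta i w)); first by move=> w; rewrite -big_nat.
apply: L2G_sum => // i /andP[_ ik]; have iN := leq_trans ik kN.
apply: (@L2G_sub _ _ _ _ (F i.+1)); first exact: Fm_sub.
apply: (@eq_L2G _ _ _ _ _ (fun w => beta i w * xi i w)).
  by move=> w; rewrite mulrC.
apply: (L2GM_present e_L2 e_indep iN); last exact: L2G_excess.
exact/L2G_beta/ltnW.
Qed.

Let lgamq k : (t <= k < N)%N -> L2G P (F k) (gamq k).
Proof.
move=> /andP[_ kN]; have Fk := FmP e k; apply: L2GD => //.
  exact/L2G_beta/ltnW.
by apply: L2GZ => //; exact/L2G_alpha/ltnW.
Qed.

Let qE k w : (t <= k < N)%N -> q k.+1 w = q k w + (xi k w - c k) * gamq k w.
Proof.
move=> /andP[tk kN]; have [_ _ _] := feedback (state k w) kN.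
rewrite -/(alpha k w) -/(beta k w) => fhE.
have -> : q k w = Y k w + (f k * state k w + h k) by rewrite /q addrA.
rewrite fhE /q /gamq stateS// /Y big_nat_recr//=.
by ring.
Qed.

(** The scheme is that for [u_opt] with a single deviating time, the martingale [q] in place of [r],
    and [rho] equal to [- (lambda / 2)], so that the second condition in [feedback] applies. *)
Lemma v_opt_optimal k vk : (t <= k < N)%N -> l2_vec P e k vk ->
  {ae P, forall w,
    Jbar P N s e lambda mu Phi k (wealth s e t z v_opt k) u_opt v_opt w <=
    Jbar P N s e lambda mu Phi k (wealth s e t z v_opt k) u_opt (set_at v_opt k vk) w}.
Proof.
move=> tkN lvk; have /andP[tk kN] := tkN.
have Fk := FmP e k; have Fm := Fm_measurable e_L2 (ltnW kN).
pose xk := wealth s e t z v_opt k.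
pose X := wealth s e k xk v_opt N; pose X' := wealth s e k xk (set_at v_opt k vk) N.
pose dv w := vk w - v_opt k w.
have luv i : L2G P (F k) (fun w => (u_opt k w - v_opt k w) i 0).
  apply: L2G_subv => j; apply: admissible_L2G tkN; first exact: u_opt_admissible.
  exact: v_opt_admissible.
have luvk i : L2G P (F k) (fun w => (u_opt k w - vk w) i 0).
  apply: L2G_subv => j; last exact/l2E.
  by apply: admissible_L2G tkN; exact: u_opt_admissible.
have ldv i : L2G P (F k) (fun w => dv w i 0).
  apply: L2G_subv => j; first exact/l2E.
  by apply: admissible_L2G tkN; exact: v_opt_admissible.
have set_atE : set_at v_opt k vk k = vk by rewrite /set_at eqxx.
have XE w : X w = q N w.
  have := @growth_wealth _ _ _ _ N s e k N xk v_opt w.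
  rewrite leqnn (ltnW kN) growthN mul1r /X => -> //.
  rewrite growth_wealth_v_opt ?tk ?(ltnW kN)// (eq_bigr _ (fun i _ => gain_v_opt i w)).
  by rewrite /q fN hN mul0r !addr0 /Y (big_cat_nat tk (ltnW kN))/= addrA.
(* Later controls are kept as random variables, not recomputed along the perturbed wealth, so their
   gains cancel. *)
have XX' w : X' w - X w = S k.+1 * ((Th k w)^T *m dv w) 0 0.
  have := @growth_wealth _ _ _ _ N s e k N xk (set_at v_opt k vk) w.
  have := @growth_wealth _ _ _ _ N s e k N xk v_opt w.
  rewrite leqnn (ltnW kN) growthN !mul1r /X /X' => -> // -> //.
  rewrite opprD addrACA subrr add0r !(big_ltn kN) set_atE opprD addrACA.
  rewrite -sumrB big_nat big1 ?addr0; last first.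
    by move=> i /andP[ki _]; rewrite /set_at gt_eqF// subrr.
  by rewrite /dv dotBr mulrBr.
have lX : L2 P X.
  apply: (@eq_L2 _ _ _ _ (q N)); first by move=> w; rewrite XE.
  by have [] := lq (k := N); rewrite ?leqnn ?(ltnW tN).
have lX' : L2 P X'.
  apply: (@eq_L2 _ _ _ _ (fun w => X w + S k.+1 * ((Th k w)^T *m dv w) 0 0)).
    by move=> w; rewrite -XX' subrKC.
  by apply: L2D => //; have [] := L2_gain kN ldv.
have lqk : L2G P (F k) (q k) by apply: lq; rewrite tk ltnW.
have orth Z : L2G P (F k) Z -> mean P (fun w => Z w * (X w - q k w)) = 0.
  move=> lZ; rewrite (@eq_mean _ _ _ _ _ (fun w => Z w * (q N w - q k w))).
    apply: (mean_martingale (gam := gamq)) lZ; first by rewrite leqnn ltnW.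
    - by move=> i /andP[ki iN]; apply: lq; rewrite iN (leq_trans tk ki).
    - by move=> i /andP[ki iN]; apply: lgamq; rewrite iN (leq_trans tk ki).
    - by move=> i w /andP[ki iN]; apply: qE; rewrite iN (leq_trans tk ki).
  by move=> w; rewrite XE.
have [mQ lQ] := measurable_quad (Phi k) luv.
have [mQ' lQ'] := measurable_quad (Phi k) luvk.
(* The penalty at time [k] is known at time [k], hence is its own conditional expectation, as [Jbar]
   requires. *)
have refl_condE f0 : measurable_wrt (F k) f0 -> L1 P f0 ->
    is_condE P (F k) (fun w => mu k * f0 w) (fun w => mu k * f0 w).
  move=> mf0 lf0; apply/(is_condEP Fm); first exact: L1Z.
  by split=> //; [apply: measurable_wrtM => //; exact: measurable_wrt_cst|exact: L1Z].
have opt A : F k A -> 0 <= mean P (fun w => \1_A w *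
    (mu k * quad (Phi k) (u_opt k w - vk w) - mu k * quad (Phi k) (u_opt k w - v_opt k w)
     + (2 * (X w - q k w) - lambda) * (X' w - X w))).
  move=> FA; have mA := Fm _ FA.
  (* The sign reflects that the deviating control enters the penalty through [u - v]. *)
  pose K w := - (mu k *: (Phi k *m (u_opt k w - v_opt k w))).
  pose D w := \1_A w * \sum_i dv w i 0 *
    (K w i 0 + S k.+1 * Th k w i 0 * (q N w - q k w + cst (- (lambda / 2)) w)).
  have KE i w : K w i 0 = - ((alpha k w - beta k w) / S k.+1 * gm k * m k i 0).
    by rewrite /K penalty_gradient// mxE [X in - X]mxE.
  have [lD D0] : L1 P D /\ mean P D = 0.
    apply: (@mean_first_order_dot q gamq) => //.
    - by move=> j /andP[kj jN]; apply: lq; rewrite jN (leq_trans tk kj).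
    - by move=> j /andP[kj jN]; apply: lgamq; rewrite jN (leq_trans tk kj).
    - by move=> j w /andP[kj jN]; apply: qE; rewrite jN (leq_trans tk kj).
    - exact: (L2G_cst P Fk).
    - move=> i; apply: (@eq_L2G _ _ _ _ _ (fun w =>
          - (gm k * m k i 0 / S k.+1) * (alpha k w - beta k w))).
        by move=> w; rewrite KE; ring.
      by apply: L2GZ => //; apply: L2GB => //; [exact/L2G_alpha/ltnW|exact/L2G_beta/ltnW].
    - move=> i w; rewrite KE /gamq /=.
      have [_ + _ _] := feedback (state k w) kN.
      rewrite -/(alpha k w) -/(beta k w) => foc.
      transitivity (S k.+1 * m k i 0 * (gm k / S k.+1 ^+ 2 *
        (beta k w - alpha k w) + beta k w + f k.+1 * alpha k w - lambda / 2));
        last by rewrite foc mulr0.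
      by field; exact: S_neq0.
  have <- : mean P (fun w => 2 * D w) = 0 by rewrite meanZ// D0 mulr0.
  apply: le_mean; first exact: L1Z.
    apply: L1_indicM => //; apply: L1D; first by apply: L1B; exact: L1Z.
    apply: L1M; last exact: L2B.
    by apply: L2B (L2_cst P lambda); apply: L2Z; apply: L2B => //; case: lqk.
  move=> w; rewrite /D mulrCA; apply: ler_wpM2l; first by rewrite indicE.
  rewrite XX' XE.
  have := penalty_convex (u_opt k w - v_opt k w) (u_opt k w - vk w) kN.
  rewrite -lerBrDl (_ : u_opt k w - vk w - _ = - dv w); last first.
    by rewrite /dv opprB opprB addrC addrA subrK.
  have -> : 2 * (\sum_i dv w i 0 * (K w i 0 + S k.+1 * Th k w i 0 *
        (q N w - q k w + cst (- (lambda / 2)) w))) =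
      2 * (\sum_i (- dv w) i 0 * (mu k *: (Phi k *m (u_opt k w - v_opt k w))) i 0) +
      (2 * (q N w - q k w) - lambda) * (S k.+1 * ((Th k w)^T *m dv w) 0 0).
    rewrite dotE !mulr_sumr -big_split/=; apply: eq_bigr => i _.
    have oppE (x : 'cV[R]_p) : (- x) i 0 = - x i 0 by rewrite mxE.
    by rewrite /K !oppE /=; field.
  by rewrite lerD2r.
have := ae_le_mean_variance Fk Fm (lambda := lambda) lX lX' lqk orth
  (L1Z (mu k) lQ) (L1Z (mu k) lQ') (refl_condE _ mQ lQ) (refl_condE _ mQ' lQ') opt.
by rewrite /Jbar set_atE.
Qed.

Lemma self_coordination_v_opt :
  self_coordination_control P N s e lambda mu Phi t z v_opt.
Proof.
split; first exact: v_opt_admissible.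
exists u_opt; split; first exact: u_opt_admissible.
- exact: u_opt_optimal.
- by move=> k tk vk lvk; exact: v_opt_optimal.
Qed.

End Coordination.

(* Only [mu_k Phi_k] enters the functionals; when it maps [y_k] to a nonnegative
   multiple of the mean excess return, the vector game is a scalar one. *)
Lemma ex_self_coordination (R : realType) (d : measure_display) (T : measurableType d)
    (P : probability T R) (p N : nat) (s : nat -> R)
    (e : nat -> T -> 'cV[R]_p) (lambda : R) (mu : nat -> R) (Phi : nat -> 'M[R]_p) :
  (forall k, (k < N)%N -> 1 < s k) ->
  (forall k, (k < N)%N -> square_integrable_vec P (e k)) ->
  independent_vectors P N e ->
  (forall k, (k < N)%N -> 0 <= mu k) ->
  (forall k, (k < N)%N -> psd (Phi k)) ->
  (forall k, (k < N)%N ->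
     in_range (cov_mx P (Theta s e k)) (mean_vec P (Theta s e k))) ->
  (forall k, (k < N)%N -> exists a1 a2 : R, [/\ 0 <= a1, 0 <= a2 &
     mu k *: Phi k = a1 *: cov_mx P (Theta s e k)
       + a2 *: (mean_vec P (Theta s e k) *m (mean_vec P (Theta s e k))^T)]) ->
  forall (t : nat) (z : T -> R), (t < N)%N -> l2 P e t z ->
    exists v : control, self_coordination_control P N s e lambda mu Phi t z v.
Proof.
move=> s_gt1 e_L2 e_indep mu_ge0 Phi_psd range cone t z tN /l2E zF.
pose m k := mean_vec P (Theta s e k).
(* Beyond the horizon the value 0 completes [y] to a total function; the same is done for [gm]. *)
have /choice[y Cy] : forall k, exists y : 'cV[R]_p,
    (k < N)%N -> cov_mx P (Theta s e k) *m y = m k.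
  move=> k; case: (boolP (k < N)%N) => [/range[y yE]|_]; first by exists y.
  by exists 0.
pose c := excess_mean P s e y.
have c0 k : (k < N)%N -> 0 <= c k.
  by move=> kN; exact: (mean_dot_ge0 (fun i => L2_Theta s e_L2 i kN) (Cy k kN)).
have /choice[gm gmP] : forall k, exists gm : R, (k < N)%N ->
    0 <= gm /\ mu k *: (Phi k *m y k) = gm *: m k.
  move=> k; case: (boolP (k < N)%N) => [kN|_]; last by exists 0.
  (* Applied to [y k], the covariance gives the mean and the rank-one part gives [c k] times it,
     whence the multiplier. *)
  have [a1 [a2 [a10 a20 muPhi]]] := cone _ kN; exists (a1 + a2 * c k) => _.
  split; first by rewrite addr_ge0// mulr_ge0// c0.
  rewrite scalemxAl muPhi mulmxDl -!scalemxAl Cy// -mulmxA.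
  by rewrite [_^T *m _]mx11_scalar mul_mx_scalar scalerA scalerDl.
have g_ge0 k : (k < N)%N -> 0 <= gm k / growth (N := N) s k.+1 ^+ 2.
  by move=> kN; rewrite divr_ge0 ?exprn_ge0 ?(gmP _ kN).1// ltW// growth_gt0.
have [a [b [f [h [alpha1 [alpha0 [beta1 [beta0 [aN bN fN hN [a0 fb]]]]]]]]]] :=
  ex_feedback (lambda / 2) g_ge0 c0.
by eexists; apply: (self_coordination_v_opt s_gt1 e_L2 e_indep mu_ge0 Phi_psd Cy
  (fun k kN => (gmP k kN).2) aN bN fN hN a0 fb tN zF).
Qed.

Theorem theorem3p2 (R : realType) (d : measure_display) (T : measurableType d)
    (P : probability T R) (p N : nat) (s : nat -> R)
    (e : nat -> T -> 'cV[R]_p) (lambda : R)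
    (mu : nat -> R) (Phi : nat -> 'M[R]_p)
    (p_gt0 : (0 < p)%N) (N_gt0 : (0 < N)%N)
    (s_gt1 : forall k, (k < N)%N -> 1 < s k)
    (e_L2 : forall k, (k < N)%N -> square_integrable_vec P (e k))
    (e_indep : independent_vectors P N e)
    (lambda_gt0 : 0 < lambda)
    (mu_ge0 : forall k, (k < N)%N -> 0 <= mu k)
    (Phi_psd : forall k, (k < N)%N -> psd (Phi k)) :
  (* i *)
  ((forall k, (k < N)%N -> mu k = 0) ->
     (forall k, (k < N)%N ->
        [/\ Tbar P N s e mu Phi k.+1 1 0 = 0,
            (forall j, (k <= j < N)%N ->
               in_range (cov_mx P (Theta s e j)) (mean_vec P (Theta s e j))) ->
            0 < Pbar P N s e mu Phi k,
            0 < Tbar P N s e mu Phi k 1 1 &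
            Tbar P N s e mu Phi k 1 1
            = s k ^+ 2 * Tbar P N s e mu Phi k.+1 1 1]) /\
     Tbar P N s e mu Phi N 1 1 = 1) /\
  (* ii *)
  ((forall k, (k < N)%N -> mu k = 0) ->
   (forall k, (k < N)%N ->
      in_range (cov_mx P (Theta s e k)) (mean_vec P (Theta s e k))) ->
   forall (t : nat) (z : T -> R), (t < N)%N -> l2 P e t z ->
     exists v : control,
       self_coordination_control P N s e lambda mu Phi t z v /\
       equilibrium_control P N s e lambda t z v) /\
  (* iii *)
  ((forall k, (k < N)%N ->
      in_range (cov_mx P (Theta s e k)) (mean_vec P (Theta s e k))) ->
   (forall k, (k < N)%N -> Xi P s e k (Phi k)) ->
   forall (t : nat) (z : T -> R), (t < N)%N -> l2 P e t z ->
     exists v : control,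
       self_coordination_control P N s e lambda mu Phi t z v).
Proof.
split; [|split].
- move=> mu0; split=> [k kN|]; last by rewrite TbarN mxE.
  have [T10 T01 T11] := Tbar_mu0 P e Phi s_gt1 mu0 kN.
  have [_ _ T11k] := Tbar_mu0 P e Phi s_gt1 mu0 (ltnW kN).
  split => //; first by move=> range; exact: (Pbar_gt0 Phi e_L2 s_gt1 mu0 (ltnW kN)).
  by rewrite TbarE// T_step1// mu0.
- move=> mu0 range t z tN zF.
  have [k kN|v sv] := ex_self_coordination lambda
    s_gt1 e_L2 e_indep mu_ge0 Phi_psd range _ tN zF.
    by exists 0, 0; split; rewrite // mu0// !scale0r addr0.
  (* With [mu] zero the penalty leaves [Jbar], and the inequality for [v] becomes the equilibrium
     condition itself. *)
  exists v; split=> //; case: sv => av [u [_ _ vopt]]; split=> // k tkN vk lvk.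
  have /andP[_ kN] := tkN.
  apply: filterS (vopt k tkN vk lvk) => w.
  by rewrite /Jbar mu0// !mul0r !add0r.
- move=> range cone t z tN zF.
  apply: ex_self_coordination => // k kN.
  have [a1 [a2 [a10 a20 ->]]] := cone k kN.
  exists (mu k * a1), (mu k * a2).
  by rewrite !mulr_ge0 ?mu_ge0// scalerDr !scalerA.
Qed.
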